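(* Assume that H1 and H2(1) hold, and let $\Pi$ be the local semiflow on $\Omega\times W^{1,\infty}$ determined by the family of state-dependent delay equations described in the context. (i) If $\mathcal{K}_0\subset\Omega\times W^{1,\infty}$ is a positively $\Pi$-invariant bounded set, then the set $$\mathcal{K}_1=\mathrm{closure}_{\Omega\times W^{1,\infty}}\{\Pi(2r,\omega,x)\,|\;(\omega,x)\in\mathcal{K}_0\}$$ is a positively $\Pi$-invariant compact set. (ii) Let $(\tilde\omega,\tilde x)\in\Omega\times W^{1,\infty}$ have bounded $\Pi$-semiorbit. Then its omega-limit set $\mathcal{O}(\tilde\omega,\tilde x)$ is well-defined, positively $\Pi$-invariant, and compact. In addition, any point $(\omega,x)\in\mathcal{O}(\tilde\omega,\tilde x)$ admits at least one backward extension in $\mathcal{O}(\tilde\omega,\tilde x)$. (iii) If $\mathcal{K}_2\subset\Omega\times W^{1,\infty}$ is a nonempty positively $\Pi$-invariant compact set, then the set $$\mathcal{K}_3=\{(\omega,x)\in\mathcal{K}_2\,|\;(\omega,x)\text{ admits a backward extension in }\mathcal{K}_2\}$$ is a nonempty positively $\Pi$-invariant compact set, and it is the maximal subset of $\mathcal{K}_2$ among the positively $\Pi$-invariant compact sets all of whose points admit a backward extension in the set.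
   Context: Fix $r>0$ and $n\ge1$. $C=C([-r,0],\mathbb{R}^n)$ with the supremum norm $\|\cdot\|_C$; $W^{1,\infty}$ is the Banach space of Lipschitz functions $\psi:[-r,0]\to\mathbb{R}^n$ with norm $\|\psi\|_{W^{1,\infty}}=\max\{\|\psi\|_C,\|\dot\psi\|_{L^\infty}\}$. For a continuous function $y$ on $[t-r,t]$, $y_t(s)=y(t+s)$, $s\in[-r,0]$. $(\Omega,\sigma,\mathbb{R})$ is a continuous flow on a compact metric space, and $\omega\cdot t=\sigma(t,\omega)$. $\mathrm{Lin}(X,Y)$ is the space of bounded linear maps with the operator norm. Consider the family of equations, for $\omega\in\Omega$, $$\dot y(t)=F(\omega\cdot t,\,y(t),\,y(t-\tau(\omega\cdot t,y_t))),\quad t\ge0,$$ with $F:\Omega\times\mathbb{R}^n\times\mathbb{R}^n\to\mathbb{R}^n$ and $\tau:\Omega\times C\to[0,r]$. Conditions: H1: $F$ is continuous and its partial derivatives with respect to the second and third arguments exist and are continuous on $\Omega\times\mathbb{R}^n\times\mathbb{R}^n$. H2(1): $\tau$ is continuous and differentiable with respect to its second argument, with $D_2\tau:\Omega\times C\to\mathrm{Lin}(C,\mathbb{R})$ continuous. Under H1 and H2(1), for each $\omega\in\Omega$ and $x\in W^{1,\infty}$ there is a unique maximal solution $y(t,\omega,x)$ with $y(s,\omega,x)=x(s)$ for $s\in[-r,0]$, defined on $[-r,\beta_{\omega,x})$ with $0<\beta_{\omega,x}\le\infty$ (known). Put $u(t,\omega,x)(s)=y(t+s,\omega,x)$, $s\in[-r,0]$,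 which belongs to $W^{1,\infty}$ for $t\in[0,\beta_{\omega,x})$, and $\Pi(t,\omega,x)=(\omega\cdot t,u(t,\omega,x))$ for $t\in[0,\beta_{\omega,x})$. ($\Pi$ satisfies the semigroup property, but need not be jointly continuous into $\Omega\times W^{1,\infty}$.) A set $\mathcal{M}\subseteq\Omega\times W^{1,\infty}$ is positively $\Pi$-invariant if for every $(\omega,x)\in\mathcal{M}$ one has $\beta_{\omega,x}=\infty$ and $\Pi(t,\omega,x)\in\mathcal{M}$ for all $t\ge0$. A point $(\omega,x)$ of a positively $\Pi$-invariant compact set $\mathcal{M}$ admits a backward extension in $\mathcal{M}$ if there is a continuous map $\theta:(-\infty,0]\to\mathcal{M}$ with $\theta(0)=(\omega,x)$ and $\Pi(t,\theta(s))=\theta(t+s)$ whenever $s\le-t\le0$. The semiorbit of $(\omega,x)$ is $\{\Pi(t,\omega,x)\,|\,t\in[0,\beta_{\omega,x})\}$; it is bounded if $\{u(t,\omega,x)\}$ is bounded in $W^{1,\infty}$. The omega-limit set $\mathcal{O}(\omega,x)$ is the set of limits in $\Omega\times W^{1,\infty}$ of sequences $(\Pi(t_m,\omega,x))$ with $t_m\uparrow\infty$; it is well-defined when $\beta_{\omega,x}=\infty$ and $\{\Pi(t,\omega,x)\,|\,t\ge r\}$ is relatively compact in $\Omega\times W^{1,\infty}$. *)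

(* Defs.v *)
From HB Require Import structures.
From mathcomp Require Import all_boot all_order all_algebra.
From mathcomp Require Import all_classical all_reals all_analysis.
From mathcomp Require Import ess_sup_inf lra.

Set Implicit Arguments.
Unset Strict Implicit.
Unset Printing Implicit Defensive.

Import Order.TTheory GRing.Theory Num.Theory.
Import numFieldNormedType.Exports.

Local Open Scope classical_set_scope.
Local Open Scope ring_scope.

(* A Lipschitz function of one real variable is
   differentiable almost everywhere; this is what makes the W^{1,oo} norm
   below subadditive. *)
Section rademacher.
Variables (R : realType).
Local Notation mu := (@lebesgue_measure R).

Let lsm_itv (g : cumulative R R) x y : x <= y ->
  lebesgue_stieltjes_measure g `]x, y]%classic = (g y - g x)%:E.
Proof.
move=> xy; rewrite /lebesgue_stieltjes_measure/= /measure_extension/=.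
rewrite measurable_mu_extE/=; last exact: is_ocitv.
by rewrite wlength_itv_bnd.
Qed.

Let half_lip_aux (f : R -> R) (x : R) :
  derivable (fun y : R => 2^-1 * y + 1 * f y) x 1 -> derivable f x 1.
Proof.
move=> dg.
have did : derivable (2^-1 \*: (@id R)) x 1 by apply/derivableZ/derivable_id.
have := derivableB dg did; congr (derivable _ x 1).
by apply/funext => y; rewrite !fctE/= mul1r addrAC subrr add0r.
Qed.

Let half_lip_ae (f : R -> R) (a b : R) : a < b ->
  (forall x y, `|f x - f y| <= 2^-1 * `|x - y|) ->
  {ae mu, forall x, a < x < b -> derivable f x 1}.
Proof.
move=> ab fL.
have fc : continuous f.
  move=> x; apply/(@cvgrPdist_le _ R^o) => e e0; near=> t.
  have h1 := fL x t.
  have h2 : `|x - t| <= e.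
    by near: t; apply: (@cvgr_dist_le _ R^o _ (nbhs x) _ id) => //; exact: cvg_id.
  by rewrite (le_trans h1)//; have := normr_ge0 (x - t); lra.
have ND (c : R) : `|c| = 1 -> nondecreasing (fun x => 2^-1 * x + c * f x).
  move=> c1 x y xy /=.
  have := fL y x; rewrite (ger0_norm (_ : 0 <= y - x)) ?subr_ge0// => H.
  have : `|c * (f y - f x)| <= 2^-1 * (y - x) by rewrite normrM c1 mul1r.
  by rewrite ler_norml => /andP[]; lra.
have RC (c : R) : right_continuous (fun x => 2^-1 * x + c * f x).
  apply: right_continuousW => x.
  by apply: (@cvgD _ R^o); apply: (@cvgMl_tmp R); [exact: cvg_id|exact: fc].
have n1 : `|1 : R| = 1 by rewrite normr1.
have n1' : `|-1 : R| = 1 by rewrite normrN normr1.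
pose g : cumulative R R := HB.pack (fun x => 2^-1 * x + 1 * f x)
  (isCumulative.Build _ _ _ _ (ND _ n1) (RC 1)).
pose h : cumulative R R := HB.pack (fun x => 2^-1 * x + -1 * f x)
  (isCumulative.Build _ _ _ _ (ND _ n1') (RC (-1))).
pose nu := lebesgue_stieltjes_measure g.
have nuI x y : x <= y -> nu `]x, y]%classic = (g y - g x)%:E by exact: lsm_itv.
have muE A : measurable A -> mu A = (nu A + lebesgue_stieltjes_measure h A)%E.
  move=> mA.
  pose m12 := measure_add nu (lebesgue_stieltjes_measure h).
  have -> : (nu A + lebesgue_stieltjes_measure h A)%E = m12 A.
    by rewrite /m12 measure_addE.
  apply: (@lebesgue_measure_unique R m12) => //.
  move=> X /ocitvP[->|[[x y]/= xy ->]]; first by rewrite !measure0.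
  rewrite lebesgue_measure_itv/= lte_fin xy.
  transitivity ((g y - g x)%:E + (h y - h x)%:E)%E.
    by rewrite -!EFinD/=; congr EFin; lra.
  by rewrite -nuI ?ltW// -lsm_itv ?ltW// -measure_addE.
have mab : measurable (`]a, b]%classic : set (measurableTypeR R)) by [].
have nuab : (nu `]a, b]%classic < +oo)%E by rewrite nuI ?ltW// ltry.
have nu_mu : mfrestr mab nuab `<< mu.
  apply/null_content_dominatesP => A mA A0; apply/eqP.
  rewrite eq_le measure_ge0 andbT.
  have nuA0 : (nu A <= 0)%E.
    by rewrite -[leRHS]A0 [leRHS](muE A mA) leeDl.
  rewrite (le_trans _ nuA0)//.
  by apply: le_measure; rewrite ?inE//; exact: measurableI.
have [phi [phi0 phif phiI nuphi]] := radon_nikodym_sigma_finite nu_mu.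
have phiIy y : mu.-integrable `]a, y]%classic phi by apply: integrableS phiI.
have phiE : EFin \o (fine \o phi) = phi by apply/funext => x /=; rewrite fineK.
have li : locally_integrable [set: R] (fine \o phi).
  by apply: open_integrable_locally => //; [exact: openT|rewrite phiE].
have := FTC1 (a := BRight a) _ li.
rewrite phiE => /(_ phiIy).
apply: filterS; first exact: (ae_filter_ringOfSetsType mu).
move=> x + /andP[ax xb] => /(_ ax)[+ _].
set F := (F in derivable F _ _) => dF.
have Fg : \forall y \near x, F y = g y - g a.
  near=> y; rewrite /F /Rintegral/=.
  have ay : a <= y by near: y; exact: lt_le_nbhsr.
  have yb : y <= b by near: y; exact: lt_le_nbhsl.
  under eq_integral do rewrite fineK//.
  rewrite -nuphi//= /mfrestr/= /mrestr/= setIidl.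
    by rewrite lsm_itv.
  by move=> z/=; rewrite !in_itv/= => /andP[-> /le_trans->].
have dg : derivable (fun y => F y + cst (g a) y) x 1.
  exact: derivableD dF (derivable_cst _ _ _).
have dg' : derivable g x 1.
  apply: near_eq_derivable dg.
  by apply: filterS Fg => y ->; rewrite /cst subrK.
exact: half_lip_aux dg'.
Unshelve. all: by end_near. Qed.

Lemma lipschitz_ae_derivable (f : R -> R) (k a b : R) :
  (forall x y, `|f x - f y| <= k * `|x - y|) ->
  {ae mu, forall x, a < x < b -> derivable f x 1}.
Proof.
move=> fL; have [ab|ba] := ltP a b; last first.
  by apply: aeW => x /andP[/lt_trans/[apply]]; rewrite ltNge ba.
pose K := 2 * (`|k| + 1).
have k0 := normr_ge0 k; have kk := ler_norm k.
have K0 : 0 < K by rewrite /K; lra.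
have Kf : {ae mu, forall x, a < x < b -> derivable (fun y => K^-1 * f y) x 1}.
  apply: half_lip_ae => // x y.
  rewrite -mulrBr normrM gtr0_norm ?invr_gt0// ler_pdivrMl// mulrA.
  rewrite (le_trans (fL _ _))// ler_wpM2r//.
  by rewrite /K; lra.
apply: filterS Kf; first exact: (ae_filter_ringOfSetsType mu).
move=> x + xab => /(_ xab) /(@derivableZ _ _ _ _ K).
rewrite (_ : K \*: _ = f)//; apply/funext => y /=.
by rewrite /GRing.scale/= mulrA divff ?mul1r// gt_eqF.
Qed.
End rademacher.

Section history_spaces.
Variables (R : realType) (r : {posnum R}) (n : nat).
Local Notation V := 'rV[R]_n.

Definition clamp (s : R) : R := Num.max (- r%:num) (Num.min s 0).

(* A function on [-r, 0] is encoded by its unique extension to R that is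
   constant on ]-oo, -r] and on [0, +oo[; only its values on [-r, 0] matter. *)
Definition cont_fun : {pred R -> V} :=
  mem [set f : R -> V |
    {within `[- r%:num, 0], continuous f} /\ forall s, f s = f (clamp s)].

Definition lip_fun : {pred R -> V} :=
  mem [set f : R -> V |
    [lipschitz f s | s in `[- r%:num, 0]] /\ forall s, f s = f (clamp s)].

Record Cspace := MkCspace { Cspace_val :> R -> V; _ : Cspace_val \in cont_fun }.

Record W1oo := MkW1oo { W1oo_val :> R -> V; _ : W1oo_val \in lip_fun }.

Definition sup_norm (f : R -> V) : R :=
  sup [set `|f s| | s in `[- r%:num, 0]].

Definition Lebesgue_itv :=
  mrestr (@lebesgue_measure R) (measurable_itv `[- r%:num, 0]).
HB.instance Definition _ := Measure.on Lebesgue_itv.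

(* The L^oo norm of the almost everywhere defined derivative; at the
   negligible set of points where f is not differentiable, derive1 f is junk. *)
Definition deriv_norm (f : R -> V) : \bar R :=
  Lnorm Lebesgue_itv +oo%E (fun s : R => `|derive1 f s|%:E).

Definition W1oo_norm (f : R -> V) : R :=
  Num.max (sup_norm f) (fine (deriv_norm f)).

Let r0 : 0 < r%:num := gt0 r.

Lemma clamp_itv s : clamp s \in `[- r%:num, 0].
Proof.
by rewrite /clamp in_itv/= le_max lexx/= ge_max ge_min lexx orbT andbT oppr_le0.
Qed.

Lemma clamp_id s : s \in `[- r%:num, 0] -> clamp s = s.
Proof.
by rewrite /clamp in_itv/= => /andP[s1 s2]; rewrite min_l// max_r.
Qed.

Lemma clamp_lip s t : `|clamp s - clamp t| <= `|s - t|.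
Proof.
have H u v : u <= v -> `|clamp u - clamp v| <= `|u - v|.
  move=> uv; rewrite distrC (distrC u) [leRHS]ger0_norm ?subr_ge0// ler_norml.
  by rewrite /clamp /Num.max /Num.min; do ![case: ifPn]; rewrite -?leNgt; lra.
have [st|/ltW st] := leP s t; first exact: H.
by rewrite distrC (distrC s); exact: H.
Qed.

Lemma lip_funP (f : R -> V) : reflect
  ((exists k, forall s t, `|f s - f t| <= k * `|s - t|) /\
   forall s, f s = f (clamp s))
  (f \in lip_fun).
Proof.
apply: (iffP idP) => [|[[k fk] fc]]; last first.
  rewrite inE; split=> //.
  have I0 : (`[- r%:num, 0] `*` `[- r%:num, 0]) (0 : R, 0 : R).
    by split; rewrite /= in_itv/= lexx andbT oppr_le0.
  have FF := globally_properfilter I0.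
  by apply: (@klipschitzW _ _ _ k) => -[s t] _ /=.
rewrite inE => -[fl fc]; split=> //.
have [k /= [k0 kf]] : exists k, 0 < k /\ (k.-lipschitz_`[(- r%:num), 0] f).
  move: fl; rewrite /lipschitz_on => fl.
  near (pinfty_nbhs R) => k; exists k; split.
    by near: k; exact: nbhs_pinfty_gt.
  by near: k.
exists k => s t.
rewrite fc (fc t).
apply: le_trans (kf (clamp s, clamp t) _) _.
  by split; exact: clamp_itv.
by rewrite ler_wpM2l ?(ltW k0)//; exact: clamp_lip.
Unshelve. all: by end_near. Qed.

Lemma cont_funP (f : R -> V) : reflect
  (continuous f /\ forall s, f s = f (clamp s)) (f \in cont_fun).
Proof.
apply: (iffP idP) => [|[fcont fc]]; last first.
  by rewrite inE; split=> //; exact: continuous_subspaceT.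
rewrite inE => -[fcont fc]; split=> //.
have -> : f = f \o clamp by apply/funext.
move=> s; apply/cvgrPdist_lt => e e0 /=.
have cs := clamp_itv s.
move/subspace_continuousP : fcont => /(_ _ cs) /cvgrPdist_lt /(_ _ e0).
rewrite /within/= => -[d /= d0 H]; exists d => //= t st.
apply: H; last exact: clamp_itv.
exact: le_lt_trans (clamp_lip _ _) st.
Qed.

Lemma lip_cont_fun f : f \in lip_fun -> f \in cont_fun.
Proof.
move=> /lip_funP[[k fk] fc]; apply/cont_funP; split=> // x.
apply/cvgrPdist_lt => e e0; near=> t.
rewrite (le_lt_trans (fk _ _))// (@le_lt_trans _ _ ((`|k| + 1) * `|x - t|))//.
  by rewrite ler_wpM2r// (le_trans (ler_norm _))// lerDl.
rewrite mulrC -ltr_pdivlMr ?ltr_wpDl//.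
near: t; apply: (@cvgr_dist_lt _ R^o _ (nbhs x) _ id); first exact: cvg_id.
by rewrite divr_gt0// ltr_wpDl.
Unshelve. all: by end_near. Qed.

Fact cont_fun_zmod : zmod_closed cont_fun.
Proof.
split=> [|f g /cont_funP[cf fc] /cont_funP[cg gc]].
  by apply/cont_funP; split=> // x; exact: cvg_cst.
apply/cont_funP; split=> [x|s]; first by apply: continuousB; [exact: cf|exact: cg].
by rewrite !fctE fc gc.
Qed.

Fact cont_fun_scale : scaler_closed cont_fun.
Proof.
move=> a f /cont_funP[cf fc]; apply/cont_funP; split=> [x|s].
  by apply: continuousZr; exact: cf.
by rewrite !fctE fc.
Qed.

HB.instance Definition _ := GRing.isZmodClosed.Build _ cont_fun cont_fun_zmod.
HB.instance Definition _ := GRing.isScaleClosed.Build R _ cont_fun cont_fun_scale.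

Fact lip_fun_zmod : zmod_closed lip_fun.
Proof.
split=> [|f g /lip_funP[[k cf] fc] /lip_funP[[l cg] gc]].
  by apply/lip_funP; split=> //; exists 0 => s t; rewrite mul0r subrr normr0.
apply/lip_funP; split=> [|s]; last by rewrite !fctE fc gc.
exists (k + l) => s t; rewrite !fctE.
have -> : f s - g s - (f t - g t) = (f s - f t) - (g s - g t).
  by rewrite !opprB addrACA [RHS]addrACA [- g s - f t]addrC.
by rewrite (le_trans (ler_normB _ _))// mulrDl lerD.
Qed.

Fact lip_fun_scale : scaler_closed lip_fun.
Proof.
move=> a f /lip_funP[[k cf] fc]; apply/lip_funP; split=> [|s].
  exists (`|a| * k) => s t.
  by rewrite !fctE -scalerBr normrZ -mulrA ler_wpM2l.
by rewrite !fctE fc.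
Qed.

HB.instance Definition _ := GRing.isZmodClosed.Build _ lip_fun lip_fun_zmod.
HB.instance Definition _ := GRing.isScaleClosed.Build R _ lip_fun lip_fun_scale.

HB.instance Definition _ := [isSub for Cspace_val].
HB.instance Definition _ := [Choice of Cspace by <:].
HB.instance Definition _ := [SubChoice_isSubLmodule of Cspace by <:].

HB.instance Definition _ := [isSub for W1oo_val].
HB.instance Definition _ := [Choice of W1oo by <:].
HB.instance Definition _ := [SubChoice_isSubLmodule of W1oo by <:].


Let sup_norm_has_sup (f : R -> V) : continuous f ->
  has_sup [set `|f s| | s in `[- r%:num, 0]].
Proof.
move=> cf; split.
  by exists `|f 0|; exists 0 => //=; rewrite in_itv/= lexx andbT oppr_le0.
have : compact (f @` `[- r%:num, 0]).
  apply: continuous_compact; last exact: segment_compact.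
  exact: continuous_subspaceT.
move=> /compact_bounded[M [_ /(_ (M + 1))]]; rewrite ltrDl => /(_ ltr01) fM.
by exists (M + 1) => _ [s sI <-]; apply: fM; exists s.
Qed.

Lemma sup_norm_ge (f : R -> V) s : continuous f -> s \in `[- r%:num, 0] ->
  `|f s| <= sup_norm f.
Proof.
move=> cf sI; have [_ ubf] := sup_norm_has_sup cf.
by apply: ub_le_sup => //; exists s.
Qed.

Lemma sup_norm_le (f : R -> V) M : continuous f ->
  (forall s, s \in `[- r%:num, 0] -> `|f s| <= M) -> sup_norm f <= M.
Proof.
move=> cf fM; have [nf _] := sup_norm_has_sup cf.
by apply: ge_sup => // _ [s sI <-]; exact: fM.
Qed.

Let sup_norm_ge0 (f : R -> V) : continuous f -> 0 <= sup_norm f.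
Proof.
move=> cf; apply: le_trans (sup_norm_ge cf (clamp_itv 0)); exact: normr_ge0.
Qed.

Let sup_normD (f g : R -> V) : continuous f -> continuous g ->
  sup_norm (f + g) <= sup_norm f + sup_norm g.
Proof.
move=> cf cg; apply: sup_norm_le.
  by move=> s; apply: continuousD; [exact: cf|exact: cg].
move=> s sI; rewrite !fctE (le_trans (ler_normD _ _))//.
by apply: lerD; exact: sup_norm_ge.
Qed.

Let sup_normZ (a : R) (f : R -> V) : continuous f ->
  sup_norm (a *: f) = `|a| * sup_norm f.
Proof.
have H (b : R) (g : R -> V) : continuous g -> sup_norm (b *: g) <= `|b| * sup_norm g.
  move=> cg; apply: sup_norm_le.
    by move=> s; apply: continuousZr; exact: cg.
  move=> s sI; rewrite !fctE normrZ ler_wpM2l//; exact: sup_norm_ge.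
move=> cf; apply/eqP; rewrite eq_le H//=.
have [->|a0] := eqVneq a 0.
  by rewrite normr0 mul0r scale0r; apply: sup_norm_ge0 => s; exact: cvg_cst.
rewrite -ler_pdivlMl ?normr_gt0// -normfV.
rewrite -[X in sup_norm X <= _](scalerK a0).
by apply: H => s; apply: continuousZr; exact: cf.
Qed.

Let sup_norm_eq0 (f : R -> V) : f \in cont_fun -> sup_norm f = 0 -> f = 0.
Proof.
move=> /cont_funP[cf fc] f0; apply/funext => s; rewrite fc.
apply/eqP; rewrite -normr_le0 -f0.
exact: (sup_norm_ge cf (clamp_itv s)).
Qed.

Let Cspace_cont (f : Cspace) : continuous f.
Proof. by have /cont_funP[] := valP f. Qed.

Definition Cspace_norm (f : Cspace) := sup_norm f.

Let Cspace_normD (f g : Cspace) :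
  Cspace_norm (f + g) <= Cspace_norm f + Cspace_norm g.
Proof. exact: (sup_normD (@Cspace_cont f) (@Cspace_cont g)). Qed.

Let Cspace_normZ (a : R) (f : Cspace) :
  Cspace_norm (a *: f) = `|a| * Cspace_norm f.
Proof. exact: (sup_normZ a (@Cspace_cont f)). Qed.

Let Cspace_norm_eq0 (f : Cspace) : Cspace_norm f = 0 -> f = 0.
Proof. by move=> f0; apply/val_inj/sup_norm_eq0 => //; exact: valP. Qed.

HB.instance Definition _ := Lmodule_isNormed.Build R Cspace
  Cspace_normD Cspace_normZ Cspace_norm_eq0.

Let ae_Lebesgue_itv (P : R -> Prop) :
  {ae (@lebesgue_measure R), forall s, - r%:num < s < 0 -> P s} ->
  {ae Lebesgue_itv, forall s, P s}.
Proof.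
move=> [N [mN N0 sN]].
exists (N `|` ~` `]- r%:num, 0[%classic); split.
- by apply: measurableU => //; apply: measurableC.
- apply/eqP; rewrite eq_le measure_ge0 andbT.
  rewrite /Lebesgue_itv/= /mrestr setIUl.
  have m1 : measurable (N `&` `[- r%:num, 0] : set (measurableTypeR R)).
    exact: measurableI.
  have -> : ~` `]- r%:num, 0[%classic `&` `[- r%:num, 0] = [set - r%:num; 0].
    apply/seteqP; split=> [s [/=]|s /=].
      rewrite !in_itv/= => /negP + /andP[s1 s2].
      rewrite negb_and -!leNgt => /orP[s3|s3]; [left|right]; apply/eqP;
        by rewrite eq_le ?s1 ?s2 ?s3.
    by move=> [->|->]; rewrite /= !in_itv/= ?ltxx ?lexx ?andbF ?oppr_le0//=
       ?andbT ?lerNl ?oppr0.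
  have m2 : measurable ([set - r%:num; 0] : set (measurableTypeR R)).
    exact: measurableU.
  apply: le_trans (measureU2 _ m1 m2) _.
  have m20 : lebesgue_measure ([set - r%:num; 0] : set R) = 0%E.
    by apply: countable_lebesgue_measure0; exact: finite_set_countable.
  rewrite [X in (_ + X)%E]m20 adde0 -N0.
  by apply: le_measure; rewrite ?inE.
- move=> s /= nP.
  have [sI|sI] := boolP (s \in `]- r%:num, 0[); last by right; exact/negP.
  by left; apply: sN => /= H; apply: nP; apply: H; move: sI; rewrite in_itv.
Qed.

Lemma lip_ae_derivable (f : R -> V) : f \in lip_fun ->
  {ae Lebesgue_itv, forall s, derivable f s 1}.
Proof.
move=> /lip_funP[[k fk] _]; apply: ae_Lebesgue_itv.
have H (j : 'I_n) : {ae (@lebesgue_measure R), forall s, - r%:num < s < 0 ->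
    derivable (fun s => f s ord0 j) s 1}.
  apply: (@lipschitz_ae_derivable _ _ k) => s t.
  apply: le_trans (fk s t); rewrite [leRHS]/Num.Def.normr/= mx_normrE.
  by apply: le_trans; last exact: (le_bigmax _ _ (ord0, j)); rewrite !mxE.
have FF := ae_filter_ringOfSetsType (@lebesgue_measure R).
have : \forall s \ae (@lebesgue_measure R), forall j, - r%:num < s < 0 ->
    derivable (fun s => f s ord0 j) s 1.
  by apply: filter_forall => j; exact: H.
apply: filterS => s Hs sI; apply/derivable_mxP => i j.
by rewrite ord1; exact: Hs.
Qed.


Let Lebesgue_itv_gt0 : (0 < Lebesgue_itv [set: measurableTypeR R])%E.
Proof.
rewrite /Lebesgue_itv/= /mrestr setTI lebesgue_measure_itv/= lte_fin.
by rewrite oppr_lt0 r0 -EFinD lte_fin add0r opprK.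
Qed.

Let FF := ae_filter_ringOfSetsType Lebesgue_itv.

Let deriv_normE (f : R -> V) :
  deriv_norm f = ess_sup Lebesgue_itv (fun s : R => `|derive1 f s|%:E).
Proof.
rewrite /deriv_norm unlock Lebesgue_itv_gt0; congr (ess_sup _ _).
by apply/funext => s /=; rewrite normr_id.
Qed.

Lemma deriv_norm_leP (f : R -> V) (y : \bar R) :
  reflect {ae Lebesgue_itv, forall s, (`|derive1 f s|%:E <= y)%E}
          (deriv_norm f <= y)%E.
Proof. by rewrite deriv_normE; exact: ess_supP. Qed.

Let deriv_norm_ge0 (f : R -> V) : (0 <= deriv_norm f)%E.
Proof.
rewrite deriv_normE; apply: ess_sup_gee; first exact: Lebesgue_itv_gt0.
by apply: aeW => s; rewrite lee_fin.
Qed.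

Lemma derive1_lip_le (f : R -> V) (k s : R) :
  (forall s t, `|f s - f t| <= k * `|s - t|) -> derivable f s 1 ->
  `|derive1 f s| <= k.
Proof.
move=> fk df; rewrite derive1E.
have /cvg_norm : h^-1 *: (f (h *: 1 + s) - f s) @[h --> 0^'] --> 'D_1 f s.
  exact: df.
move=> H; rewrite -(cvg_lim _ H)//; apply: limr_le.
  by apply/cvg_ex; exists `|'D_1 f s|.
near=> h; rewrite normrZ normfV ler_pdivrMl.
  rewrite mulrC (le_trans (fk _ _))//.
  by rewrite addrK [_ *: _]mulr1.
by rewrite normr_gt0; near: h; exact: nbhs_dnbhs_neq.
Unshelve. all: by end_near. Qed.

Lemma deriv_norm_lip_le (f : R -> V) (k : R) : f \in lip_fun ->
  (forall s t, `|f s - f t| <= k * `|s - t|) -> (deriv_norm f <= k%:E)%E.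
Proof.
move=> fl fk; apply/deriv_norm_leP.
apply: (@filterS _ _ FF _ _ _ (lip_ae_derivable fl)) => s df.
by rewrite lee_fin; exact: derive1_lip_le.
Qed.

Lemma deriv_norm_fin (f : R -> V) : f \in lip_fun ->
  deriv_norm f \is a fin_num.
Proof.
move=> fl; have /lip_funP[[k fk] _] := fl.
rewrite ge0_fin_numE ?deriv_norm_ge0//.
by rewrite (le_lt_trans (deriv_norm_lip_le fl fk))// ltry.
Qed.

Let derive1D_le (f g : R -> V) (s : R) :
  derivable f s 1 -> derivable g s 1 ->
  `|derive1 (f + g)%R s| <= `|derive1 f s| + `|derive1 g s|.
Proof.
move=> df dg; have dfg := deriveD df dg.
rewrite (derive1E (f + g)%R s) dfg (derive1E f s) (derive1E g s).
exact: ler_normD.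
Qed.

Let deriv_normD (f g : R -> V) : f \in lip_fun -> g \in lip_fun ->
  (deriv_norm (f + g)%R <= deriv_norm f + deriv_norm g)%E.
Proof.
move=> fl gl; apply/deriv_norm_leP.
have /deriv_norm_leP Hf := lexx (deriv_norm f).
have /deriv_norm_leP Hg := lexx (deriv_norm g).
apply: (@filterS2 _ _ FF _ _ _ _
  (@filterI _ _ FF _ _ (lip_ae_derivable fl) (lip_ae_derivable gl))
  (@filterI _ _ FF _ _ Hf Hg)) => s [df dg] [sf sg].
apply: le_trans (leeD sf sg); rewrite -EFinD lee_fin.
exact: derive1D_le.
Qed.

Let deriv_normZ (a : R) (f : R -> V) : f \in lip_fun ->
  deriv_norm (a *: f)%R = (`|a|%:E * deriv_norm f)%E.
Proof.
move=> fl; rewrite !deriv_normE -ess_supZl//.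
apply: eq_ess_sup; apply: (@filterS _ _ FF _ _ _ (lip_ae_derivable fl)) => s df /=.
by rewrite derive1E deriveZ// -derive1E normrZ EFinM.
Qed.

Let W1oo_cont (f : W1oo) : continuous f.
Proof. by have /lip_cont_fun/cont_funP[] := valP f. Qed.

Let W1oo_fin (f : W1oo) : deriv_norm f \is a fin_num.
Proof. exact/deriv_norm_fin/valP. Qed.

Let W1oo_normD (f g : W1oo) :
  W1oo_norm (f + g : W1oo) <= W1oo_norm f + W1oo_norm g.
Proof.
rewrite /W1oo_norm ge_max; apply/andP; split.
  apply: le_trans (sup_normD (@W1oo_cont f) (@W1oo_cont g)) _.
  by rewrite lerD// le_max lexx.
have := deriv_normD (valP f) (valP g).
rewrite -(fineK (W1oo_fin f)) -(fineK (W1oo_fin g)) -EFinD.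
rewrite -(fineK (W1oo_fin (f + g))) lee_fin => /le_trans; apply.
by rewrite lerD// le_max lexx orbT.
Qed.

Let W1oo_normZ (a : R) (f : W1oo) :
  W1oo_norm (a *: f : W1oo) = `|a| * W1oo_norm f.
Proof.
rewrite /W1oo_norm maxr_pMr//; congr Num.max.
  exact: (sup_normZ a (@W1oo_cont f)).
by rewrite [X in fine X](deriv_normZ a (valP f)) fineM//; exact: W1oo_fin.
Qed.

Let W1oo_norm_eq0 (f : W1oo) : W1oo_norm f = 0 -> f = 0.
Proof.
move=> f0; apply/val_inj/sup_norm_eq0; first exact/lip_cont_fun/valP.
apply/eqP; rewrite eq_le sup_norm_ge0 ?andbT; last exact: W1oo_cont.
by rewrite -f0 le_max lexx.
Qed.

HB.instance Definition _ := Lmodule_isNormed.Build R W1oo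
  W1oo_normD W1oo_normZ W1oo_norm_eq0.

End history_spaces.

Section delay_equation.
Context (R : realType) (r : {posnum R}) (n : nat) (Omega : metricType R).
Local Notation V := 'rV[R]_n.
Local Notation C := (Cspace r n).
Local Notation W := (W1oo r n).

(* y_t as an element of C, resp. W^{1,oo}; the value is 0 when y_t is not
   continuous, resp. Lipschitz, on [-r, 0]. *)
Definition segC (y : R -> V) (t : R) : C :=
  insubd (0 : C) (fun s => y (t + clamp r s)).

Definition segW (y : R -> V) (t : R) : W :=
  insubd (0 : W) (fun s => y (t + clamp r s)).

Lemma segCE (y : R -> V) (t s : R) :
  {within `[t - r%:num, t], continuous y} -> s \in `[- r%:num, 0] ->
  segC y t s = y (t + s).
Proof.
move=> cy sI; rewrite /segC -[LHS]/(val _ s) insubdK ?clamp_id//.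
apply/cont_funP; split=> [u|u]; last by rewrite (clamp_id (clamp_itv r u)).
apply/cvgrPdist_lt => e e0 /=.
have shI v : t + clamp r v \in `[t - r%:num, t].
  have := clamp_itv r v; rewrite !in_itv/= => /andP[v1 v2].
  by rewrite lerD2l v1/= gerDl.
move/subspace_continuousP : cy => /(_ _ (shI u)) /cvgrPdist_lt /(_ _ e0).
rewrite /within/= => -[d /= d0 H]; exists d => //= v uv.
apply: H; last exact: shI.
rewrite /= opprD addrACA subrr add0r.
exact: le_lt_trans (clamp_lip _ _ _) uv.
Qed.

Lemma segWE (y : R -> V) (t s : R) :
  [lipschitz y u | u in `[t - r%:num, t]] -> s \in `[- r%:num, 0] ->
  segW y t s = y (t + s).
Proof.
move=> ly sI; rewrite /segW -[LHS]/(val _ s) insubdK ?clamp_id//.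
apply/lip_funP; split=> [|u]; last by rewrite (clamp_id (clamp_itv r u)).
have [k [k0 ky]] : exists k, 0 < k /\ k.-lipschitz_`[(t - r%:num), t] y.
  move: ly; rewrite /lipschitz_on => ly.
  near (pinfty_nbhs R) => k; exists k; split.
    by near: k; exact: nbhs_pinfty_gt.
  by near: k.
have shI v : t + clamp r v \in `[t - r%:num, t].
  have := clamp_itv r v; rewrite !in_itv/= => /andP[v1 v2].
  by rewrite lerD2l v1/= gerDl.
exists k => u v.
apply: le_trans (ky (t + clamp r u, t + clamp r v) _) _.
  by split; exact: shI.
rewrite ler_wpM2l ?(ltW k0)//= opprD addrACA subrr add0r.
exact: clamp_lip.
Unshelve. all: by end_near. Qed.

Definition continuous_flow (sigma : R -> Omega -> Omega) : Prop :=
  [/\ continuous (fun p : R * Omega => sigma p.1 p.2),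
      forall w, sigma 0 w = w &
      forall (s t : R) (w : Omega), sigma (s + t) w = sigma s (sigma t w)].

Definition cond_H1 (F : Omega * V * V -> V) : Prop :=
  [/\ continuous F,
      forall (w : Omega) (u v : V), differentiable (fun u' : V => F (w, u', v)) u,
      forall (w : Omega) (u v : V), differentiable (fun v' : V => F (w, u, v')) v,
      continuous (fun p : Omega * V * V =>
        'J (fun u => F (p.1.1, u, p.2)) p.1.2) &
      continuous (fun p : Omega * V * V =>
        'J (fun v => F (p.1.1, p.1.2, v)) p.2)].

Definition op_norm (L : C -> R) : R :=
  sup [set `|L x| | x in [set x : C | `|x| <= 1]].

Definition D2 (tau : Omega * C -> R) (p : Omega * C) : C -> R :=
  'd (fun x : C => tau (p.1, x)) (p.2).

Definition cond_H2_1 (tau : Omega * C -> R) : Prop :=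
  [/\ continuous tau,
      forall (w : Omega) (x : C), differentiable (fun x' : C => tau (w, x')) x &
      forall p0 : Omega * C,
        op_norm (D2 tau p \- D2 tau p0) @[p --> p0] --> (0 : R)].

Variables (sigma : R -> Omega -> Omega) (F : Omega * V * V -> V)
  (tau : Omega * C -> R).

Definition rhs (w : Omega) (y : R -> V) (t : R) : V :=
  F (sigma t w, y t, y (t - tau (sigma t w, segC y t))).

(* The derivative is taken relative to [0, +oo[: two-sided for t > 0 and
   one-sided at t = 0. *)
Definition is_solution (w : Omega) (x : W) (b : \bar R) (y : R -> V) : Prop :=
  [/\ (0 < b)%E,
      forall s : R, s \in `[- r%:num, 0] -> y s = x s,
      {within [set t : R | - r%:num <= t /\ (t%:E < b)%E], continuous y} &
      forall t : R, 0 <= t -> (t%:E < b)%E ->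
        h^-1 *: (y (t + h) - y t) @[h --> within [set h : R | 0 <= t + h] 0^']
          --> rhs w y t].

Definition is_maximal_solution (w : Omega) (x : W) (b : \bar R) (y : R -> V)
    : Prop :=
  is_solution w x b y /\
  forall b' y', is_solution w x b' y' ->
    (b' <= b)%E /\
    forall t : R, - r%:num <= t -> (t%:E < b')%E -> y' t = y t.

(* beta w x and y w x are the right end of the maximal interval and the
   maximal solution starting from (w, x). *)
Variables (beta : Omega -> W -> \bar R) (y : Omega -> W -> R -> V).

Definition semiflow (t : R) (p : Omega * W) : Omega * W :=
  (sigma t p.1, segW (y p.1 p.2) t).

Definition pos_invariant (M : set (Omega * W)) : Prop :=
  forall p, M p ->
    beta p.1 p.2 = +oo%E /\ forall t : R, 0 <= t -> M (semiflow t p).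

Definition backward_extension (M : set (Omega * W)) (p : Omega * W) : Prop :=
  exists theta : R -> Omega * W,
    [/\ {within `]-oo, 0], continuous theta},
        forall s : R, s <= 0 -> M (theta s),
        theta 0 = p &
        forall s t : R, 0 <= t -> s <= - t ->
          semiflow t (theta s) = theta (t + s)].

Definition semiorbit (p : Omega * W) : set (Omega * W) :=
  [set semiflow t p | t in [set t : R | 0 <= t /\ (t%:E < beta p.1 p.2)%E]].

(* As Omega is compact, only the W-component matters. *)
Definition bounded_in_W (M : set (Omega * W)) : Prop :=
  bounded_set (snd @` M).

Definition omega_well_defined (p : Omega * W) : Prop :=
  beta p.1 p.2 = +oo%E /\
  precompact [set semiflow t p | t in [set t : R | r%:num <= t]].

Definition omega_limit (p : Omega * W) : set (Omega * W) :=
  [set q | exists t : nat -> R,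
    [/\ forall m, 0 <= t m, nondecreasing_seq t, t @ \oo --> +oo &
        semiflow (t m) p @[m --> \oo] --> q]].

End delay_equation.

(* Main.v *)
Require Import Defs.
From HB Require Import structures.
From mathcomp Require Import all_boot all_order all_algebra.
From mathcomp Require Import all_classical all_reals all_analysis.
From mathcomp Require Import lra.

Set Implicit Arguments.
Unset Strict Implicit.
Unset Printing Implicit Defensive.

Import Order.TTheory GRing.Theory Num.Theory.
Import numFieldNormedType.Exports.

Local Open Scope classical_set_scope.
Local Open Scope ring_scope.

(* A trajectory whose values are bounded by M is L-Lipschitz for L a bound of |F|
   over the M-balls, and pointwise limits along an ultrafilter of M-bounded
   equi-Lipschitz trajectories exist, are locally uniform and are again
   trajectories. When the equation holds on [b - r, b], it turns this into uniform
   convergence of the derivatives there, so the segments at b converge in W^{1,oo}. By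
   uniqueness the limit trajectory is the one that the semiflow follows. Thus the
   segments of such trajectories form a compact set, limits of semiflow images
   are semiflow images of limits, and having a backward extension means lying on
   an entire trajectory, a property stable under limits. *)

(** * Lipschitz functions and the mean value form of differential equations *)

Section rates.
Context (R : realType) (n : nat).
Local Notation V := 'rV[R]_n.
Implicit Types (z f : R -> V) (a b k : R).

(** The obstacle is that the semiflow need not be continuous into W^{1,oo}: translation is not
    continuous on Lipschitz functions, and bounded sets are not relatively compact there. So limits
    are taken of whole trajectories, in the pointwise topology, and convergence in W^{1,oo} is
    recovered only afterwards, from the equation. Ultrafilters play the role of the diagonal
    subsequences of Arzela and Ascoli.

    The time 2r in (i) is r + r. After time r a segment consists of values produced by the equation,
    which gives one Lipschitz constant for all initial functions; after another r, the delayed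
    arguments of the equation along the whole segment lie in that range too. In (iii), entire
    trajectories carry common bounds and so form a closed family, and the omega-limit set of any
    point of K2 provides points of K3. *)

Definition lip k z := forall s t, `|z s - z t| <= k * `|s - t|.

Lemma lip_le k z :
  (forall s t, s <= t -> `|z t - z s| <= k * (t - s)) -> lip k z.
Proof.
move=> kz s t; have [st|/ltW ts] := leP s t.
  by rewrite distrC (distrC s) (ger0_norm (_ : 0 <= t - s)) ?subr_ge0//; exact: kz.
by rewrite (ger0_norm (_ : 0 <= s - t)) ?subr_ge0//; exact: kz.
Qed.

Lemma lip_glue k b z :
  (forall s t, s <= t -> t <= b -> `|z t - z s| <= k * (t - s)) ->
  (forall s t, b <= s -> s <= t -> `|z t - z s| <= k * (t - s)) -> lip k z.
Proof.
move=> zl zr; apply: lip_le => s t st.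
have [tb|/ltW bt] := leP t b; first exact: zl.
have [bs|/ltW sb] := leP b s; first exact: zr.
rewrite -(subrKA (z b)) (le_trans (ler_normD _ _))//.
have := zl _ _ sb (lexx b); have := zr _ _ (lexx b) bt; lra.
Qed.

(** Lets the argument move with the index, as state-dependent delays do: the common Lipschitz
    constant bounds the effect of replacing [ti i] by [t]. *)
Lemma lip_cvg k z (I : Type) (G : set_system I) (FG : Filter G) (zi : I -> R -> V)
    (ti : I -> R) (t : R) :
  (\forall i \near G, lip k (zi i)) -> zi i t @[i --> G] --> z t ->
  ti i @[i --> G] --> t -> zi i (ti i) @[i --> G] --> z t.
Proof.
move=> kz zt tit; apply/cvgrPdist_le => e e0.
have e2 : 0 < e / 2 by rewrite divr_gt0.
(* The sign of [k] is not assumed; this is a positive majorant to divide by. *)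
have k1 : 0 < `|k| + 1 by rewrite ltr_wpDl.
near=> i.
rewrite -(subrKA (zi i t)) (le_trans (ler_normD _ _))// (splitr e) lerD//.
  by near: i; apply: cvgr_dist_le zt _ e2.
have kzi : lip k (zi i) by near: i.
rewrite (le_trans (kzi _ _))// (@le_trans _ _ ((`|k| + 1) * `|t - ti i|))//.
  by rewrite ler_wpM2r// (le_trans (ler_norm _))// lerDl.
rewrite mulrC -ler_pdivlMr//.
near: i; apply: (@cvgr_dist_le _ R^o _ G _ ti) => //.
by rewrite divr_gt0.
Unshelve. all: by end_near. Qed.

Lemma lip_continuous k z : lip k z -> continuous z.
Proof.
move=> kz t; apply: (@lip_cvg k z R (nbhs t) _ (fun=> z) id t).
- exact: nearW.
- exact: cvg_cst.
- exact: cvg_id.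
Qed.

(* "z' = f on [a, b]" in mean value form: for continuous f it is equivalent to
   the differential equation, but it shifts, glues and passes to limits without
   mentioning derivatives. *)
Definition has_rate z f a b := forall s t, a <= s -> s <= t -> t <= b ->
  forall c e, (forall u, s <= u -> u <= t -> `|f u - c| <= e) ->
  `|z t - z s - (t - s) *: c| <= e * (t - s).

Lemma has_rate_sub z f a b a' b' : a <= a' -> b' <= b ->
  has_rate z f a b -> has_rate z f a' b'.
Proof.
move=> aa bb zf s t as_ st tb; apply: zf => //; first exact: le_trans as_.
exact: le_trans bb.
Qed.

Lemma eq_has_rate z f z' f' a b :
  (forall t, a <= t -> t <= b -> z' t = z t /\ f' t = f t) ->
  has_rate z f a b -> has_rate z' f' a b.
Proof.
move=> E zf s t as_ st tb c e H.
have sb := le_trans st tb; have at_ := le_trans as_ st.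
rewrite (E t at_ tb).1 (E s as_ sb).1; apply: zf => // u su ut.
by rewrite -(E u (le_trans as_ su) (le_trans ut tb)).2; exact: H.
Qed.

Lemma has_rate_shift z f a b t0 : has_rate z f a b ->
  has_rate (fun t => z (t0 + t)) (fun t => f (t0 + t)) (a - t0) (b - t0).
Proof.
move=> zf s t as_ st tb c e H.
have -> : t - s = t0 + t - (t0 + s) by rewrite opprD addrACA subrr add0r.
apply: zf; rewrite ?lerD2l//; [by rewrite addrC -lerBlDr|by rewrite addrC -lerBrDr|].
move=> u su ut; have := H (u - t0); rewrite [t0 + _]addrC subrK.
by apply; [rewrite lerBrDr addrC|rewrite lerBlDr addrC].
Qed.

Lemma has_rate_glue z f a b b' :
  has_rate z f a b -> has_rate z f b b' -> has_rate z f a b'.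
Proof.
move=> zl zr s t as_ st tb c e H.
have [tb'|/ltW bt] := leP t b; first exact: zl.
have [bs|/ltW sb] := leP b s; first exact: zr.
have -> : z t - z s - (t - s) *: c =
    (z t - z b - (t - b) *: c) + (z b - z s - (b - s) *: c).
  rewrite addrACA subrKA -opprD -scalerDl; congr (_ - _ *: _); lra.
rewrite (le_trans (ler_normD _ _))//.
have H1 : `|z t - z b - (t - b) *: c| <= e * (t - b).
  by apply: zr => // u bu ut; apply: H => //; exact: le_trans bu.
have H2 : `|z b - z s - (b - s) *: c| <= e * (b - s).
  by apply: zl => // u su ub; apply: H => //; exact: le_trans bt.
lra.
Qed.

Lemma has_rate_lim (I : Type) (G : set_system I) (FG : ProperFilter G)
    (zi fi : I -> R -> V) z f a b :
  (forall t, zi i t @[i --> G] --> z t) ->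
  (forall e, 0 < e ->
    \forall i \near G, forall t, a <= t -> t <= b -> `|fi i t - f t| <= e) ->
  (\forall i \near G, has_rate (zi i) (fi i) a b) -> has_rate z f a b.
Proof.
move=> zt fe zf s t as_ st tb c e H.
have L : zi i t - zi i s - (t - s) *: c @[i --> G] --> z t - z s - (t - s) *: c.
  by apply: cvgB; [apply: cvgB; exact: zt|exact: cvg_cst].
apply/ler_addgt0Pr => d d0.
(* Replacing [f] by [fi i] costs [d'] in the rate, hence at most [d] in the increment; the [+ 1]
   covers [s = t]. *)
pose d' := d / (t - s + 1).
have ts : 0 <= t - s by rewrite subr_ge0.
have d'0 : 0 < d' by rewrite divr_gt0// ltr_wpDl.
have -> : `|z t - z s - (t - s) *: c| = lim (`|zi i t - zi i s - (t - s) *: c| @[i --> G]).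
  by apply/esym/cvg_lim => //; apply: cvg_norm.
apply: limr_le.
  by apply/cvg_ex; eexists; apply: cvg_norm; exact: L.
near=> i.
have zfi : has_rate (zi i) (fi i) a b by near: i.
have fie : forall t, a <= t -> t <= b -> `|fi i t - f t| <= d'.
  by near: i; exact: fe.
apply: (@le_trans _ _ ((d' + e) * (t - s))).
  apply: zfi => // u su ut; rewrite -(subrKA (f u)) (le_trans (ler_normD _ _))//.
  by rewrite lerD ?H ?fie//; [exact: le_trans su|exact: le_trans tb].
rewrite mulrDl addrC lerD2l /d' -mulrA ler_piMr ?ltW//.
by rewrite mulrC ltr_pdivrMr ?ltr_wpDl// mul1r ltrDl.
Unshelve. all: by end_near. Qed.

(** Both sides of the defining inequality are continuous in the right endpoint. This carries the
    equation up to a finite end of the interval of existence. *)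
Lemma has_rate_closed z f a b : a < b -> continuous z ->
  (forall b', b' < b -> has_rate z f a b') -> has_rate z f a b.
Proof.
move=> ab cz zf s t as_ st tb c e H.
move: tb; rewrite le_eqVlt => /predU1P[tb|tb]; last by apply: (zf t).
move: st; rewrite le_eqVlt => /predU1P[<-|st].
  by rewrite !subrr scale0r subrr normr0 mulr0.
have L : `|z u - z s - (u - s) *: c| - e * (u - s) @[u --> t^'-] -->
    `|z t - z s - (t - s) *: c| - e * (t - s).
  have cid : (u : R) @[u --> t^'-] --> t by apply: cvg_at_left_filter; exact: cvg_id.
  apply: (@cvgB _ R^o).
    apply: cvg_norm; apply: cvgB.
      by apply: cvgB; [apply: cvg_at_left_filter; exact: cz|exact: cvg_cst].
    by apply: cvgZr_tmp; apply: (@cvgB _ R^o) => //; exact: cvg_cst.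
  by apply: (@cvgMl_tmp R); apply: (@cvgB _ R^o) => //; exact: cvg_cst.
rewrite -subr_le0 -(cvg_lim _ L)//; apply: limr_le; first by apply/cvg_ex; eexists; exact: L.
near=> u; rewrite subr_le0.
have su : s <= u by near: u; exact: nbhs_left_ge.
have ut : u < t by near: u; exact: nbhs_left_lt.
apply: (zf u) => //; first by rewrite -tb.
by move=> v sv vu; apply: H => //; rewrite (le_trans vu)// ltW.
Unshelve. all: by end_near. Qed.

(** Take [c = f t]; then [e] bounds the oscillation of [f] near [t]. At [t = a] the filter gives the
    one-sided derivative that [is_solution] asks for at time 0. *)
Lemma has_rate_cvg z f a b t : has_rate z f a b -> {for t, continuous f} ->
  a <= t -> t < b ->
  h^-1 *: (z (t + h) - z t) @[h --> within [set h | a <= t + h] 0^'] --> f t.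
Proof.
move=> zf cf at_ tb; apply/cvgrPdist_le => e e0.
have /(cvgr_dist_le) /(_ e e0) [/= d d0 fd] := cf.
rewrite near_withinE; near=> h => ah.
have h0 : h != 0 by near: h; exact: nbhs_dnbhs_neq.
have hd : `|h| < d by near: h; exact: dnbhs0_lt.
have hb : `|h| < b - t by near: h; apply: dnbhs0_lt; rewrite subr_gt0.
rewrite distrC -[X in _ - X](scalerK h0) -scalerBr normrZ normfV ler_pdivrMl ?normr_gt0//.
rewrite mulrC.
have [hp|hn] := leP 0 h.
  have := zf t (t + h) at_ _ _ (f t) e; rewrite (_ : t + h - t = h); last by lra.
  rewrite (ger0_norm hp); apply; first by lra.
    by move: hb; rewrite (ger0_norm hp); lra.
  move=> u tu ut; rewrite distrC; apply: fd; rewrite /ball_/=.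
  by move: hd; rewrite (ger0_norm hp) distrC ger0_norm; lra.
have H : `|z t - z (t + h) - (- h) *: f t| <= e * (- h).
  have -> : - h = t - (t + h) by lra.
  apply: zf => //; [lra|exact: ltW|move=> u tu ut].
  rewrite distrC; apply: fd; rewrite /ball_/=.
  by move: hd; rewrite (ltr0_norm hn) ger0_norm; lra.
rewrite (ltr0_norm hn); apply: le_trans H.
by rewrite scaleNr -[leLHS]normrN opprD opprB.
Unshelve. all: by end_near. Qed.

Lemma cvg_withinP (T U : Type) (G : set_system T) (A : set T) (h : T -> U)
    (l : set_system U) : Filter G -> G A ->
  h @ within A G `=>` l -> h @ G `=>` l.
Proof.
by move=> FG GA H P /H; apply: filterS2 GA => t At; exact.
Qed.

(** The norm is the maximum of the coordinates, so the scalar mean value theorem can be applied to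
    each coordinate at its own intermediate point. *)
Lemma mean_value_le z f a b e : a <= b -> {within `[a, b], continuous z} ->
  (forall t, a < t < b -> h^-1 *: (z (t + h) - z t) @[h --> 0^'] --> f t) ->
  (forall t, a < t < b -> `|f t| <= e) -> `|z b - z a| <= e * (b - a).
Proof.
rewrite le_eqVlt => /predU1P[-> *|ab cz dz fe].
  by rewrite !subrr normr0 mulr0.
(* The maximum over coordinates starts from 0, so [e] must be nonnegative; the midpoint shows it. *)
have e0 : 0 <= e.
  apply: le_trans (fe ((a + b) / 2) _); first exact: normr_ge0.
  by rewrite !midf_lt.
rewrite [leLHS]/Num.Def.normr/= mx_normrE (bigmax_le _ _) ?mulr_ge0 ?subr_ge0 ?(ltW ab)//.
move=> -[i j] _ /=; rewrite !mxE.
have [t|//|t] := @MVT R (fun t => z t i j) (fun t => f t i j) a b ab.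
- rewrite in_itv/= => tab; 
  have Q : h^-1 *: (z (h *: 1 + t) i j - z t i j) @[h --> 0^'] --> f t i j.
    have -> : (fun h => h^-1 *: (z (h *: 1 + t) i j - z t i j)) =
        (fun M : V => M i j) \o (fun h => h^-1 *: (z (t + h) - z t)).
      apply/funext => h /=.
      have -> : h *: 1 + t = t + h :> R by rewrite [h *: 1]mulr1 addrC.
      by rewrite !mxE.
    apply: (@cvg_comp _ _ _ _ (fun M : V => M i j) _ (nbhs (f t))).
      exact: dz.
    exact: coord_continuous.
  apply: DeriveDef.
    apply/cvg_ex; exists (f t i j); exact: Q.
  by apply/cvg_lim => //; exact: Q.
- apply/subspace_continuousP => t tab.
  apply: (@cvg_comp _ _ _ z (fun M : V => M i j) _ (nbhs (z t))); last exact: coord_continuous.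
  by move/subspace_continuousP : cz; exact.
- rewrite in_itv/= => tab ->; rewrite normrM (gtr0_norm (_ : 0 < b - a)) ?subr_gt0//.
  rewrite ler_wpM2r ?subr_ge0 ?(ltW ab)// (le_trans _ (fe t tab))//.
  rewrite [leRHS]/Num.Def.normr/= mx_normrE.
  exact: (le_bigmax _ (fun ij => `|f t ij.1 ij.2|) (i, j)).
Qed.

(** The mean value inequality is applied to [z u - (u - s) *: c], whose derivative is [f u - c]. *)
Lemma derive_has_rate z f a b : {within `[a, b], continuous z} ->
  (forall t, a < t < b -> h^-1 *: (z (t + h) - z t) @[h --> 0^'] --> f t) ->
  has_rate z f a b.
Proof.
move=> cz dz s t as_ st tb c e H.
have := @mean_value_le (fun u => z u - (u - s) *: c) (fun u => f u - c) s t e st.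
rewrite subrr scale0r subr0 addrAC; apply.
- apply/subspace_continuousP => u suI; apply: cvgB.
    move: u suI; apply/subspace_continuousP; apply: continuous_subspaceW cz => u /=.
    by rewrite !in_itv/= => /andP[su ut]; rewrite (le_trans as_)// (le_trans ut).
  apply: cvgZr_tmp; apply: cvg_within_filter.
  by apply: (@cvgB _ R^o); [exact: cvg_id|exact: cvg_cst].
- move=> u /andP[su ut].
  have : h^-1 *: (z (u + h) - z u) - c @[h --> 0^'] --> f u - c.
    apply: cvgB; last exact: cvg_cst.
    by apply: dz; rewrite (le_lt_trans as_)//= (lt_le_trans ut).
  apply: cvg_trans; apply: near_eq_cvg; near=> h.
  have h0 : h != 0 by near: h; exact: nbhs_dnbhs_neq.
  rewrite -[X in _ - X = _](scalerK h0) -scalerBr; congr (_ *: _).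
  have -> : u + h - s = h + (u - s) by lra.
  by rewrite scalerDl opprB opprD [X in _ = X + _]addrA subrKA addrAC.
- by move=> u /andP[su ut]; apply: H; exact: ltW.
Unshelve. all: by end_near. Qed.

(** Two [has_rate] inequalities cannot be subtracted without loss, since each compares a rate with a
    constant. Going back to derivatives compares [f] with [f'] pointwise. *)
Lemma has_rate_diff z f z' f' a b e : continuous z -> continuous z' ->
  continuous f -> continuous f' -> has_rate z f a b -> has_rate z' f' a b ->
  (forall t, a <= t -> t <= b -> `|f t - f' t| <= e) ->
  forall s t, a <= s -> s <= t -> t <= b ->
  `|(z t - z' t) - (z s - z' s)| <= e * (t - s).
Proof.
move=> cz cz' cf cf' zf zf' ffe s t as_ st tb.
have D y g u : continuous g -> has_rate y g a b -> s < u < t ->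
    h^-1 *: (y (u + h) - y u) @[h --> 0^'] --> g u.
  move=> cg yg /andP[su ut].
  have au : a < u by exact: le_lt_trans su.
  apply: (@cvg_withinP _ _ _ [set h | a <= u + h]); last first.
    apply: has_rate_cvg yg _ _ _; [exact: cg|exact: ltW|exact: lt_le_trans tb].
  near=> h.
  have : `|h| <= u - a by near: h; apply: dnbhs0_le; rewrite subr_gt0.
  by rewrite ler_norml /= => /andP[]; lra.
apply: (@mean_value_le (fun u => z u - z' u) (fun u => f u - f' u)) => //.
- by apply: continuous_subspaceT => u; apply: cvgB; [exact: cz|exact: cz'].
- move=> u ut.
  have : h^-1 *: (z (u + h) - z u) - h^-1 *: (z' (u + h) - z' u) @[h --> 0^']
      --> f u - f' u by apply: cvgB; exact: D.
  apply: cvg_trans; apply: near_eq_cvg; apply: nearW => h /=.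
  rewrite -scalerBr; congr (_ *: _).
  by rewrite !opprB addrACA [RHS]addrACA; congr (_ + _); rewrite addrC.
- move=> u /andP[su ut]; apply: ffe; first by rewrite (le_trans as_)// ltW.
  by rewrite (le_trans (ltW ut)).
Unshelve. all: by end_near. Qed.
End rates.

(** * Segments of Lipschitz functions and their norms *)

Section segments.
Context (R : realType) (r : {posnum R}) (n : nat).
Local Notation V := 'rV[R]_n.
Local Notation C := (Cspace r n).
Local Notation W := (W1oo r n).
Implicit Types (z : R -> V) (k t : R).

Lemma eq_segC (y z : R -> V) t :
  (forall s, t - r%:num <= s <= t -> y s = z s) -> segC r y t = segC r z t.
Proof.
move=> yz; congr insubd; apply/funext => s; apply: yz.
have := clamp_itv r s; rewrite in_itv/= => /andP[s1 s2].
by rewrite lerD2l s1/= gerDl.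
Qed.

Lemma eq_segW (y z : R -> V) t :
  (forall s, t - r%:num <= s <= t -> y s = z s) -> segW r y t = segW r z t.
Proof.
move=> yz; congr insubd; apply/funext => s; apply: yz.
have := clamp_itv r s; rewrite in_itv/= => /andP[s1 s2].
by rewrite lerD2l s1/= gerDl.
Qed.

(** A Lipschitz [z] never triggers the default value 0 of [segW], so its segments can be computed
    pointwise. *)
Lemma segW_lip k z t s : lip k z -> segW r z t s = z (t + clamp r s).
Proof.
move=> kz; rewrite /segW -[LHS]/(val _ s) insubdK//.
apply/lip_funP; split=> [|u]; last by rewrite (clamp_id (clamp_itv r u)).
exists `|k| => u v; rewrite (le_trans (kz _ _))//.
rewrite (@le_trans _ _ (`|k| * `|t + clamp r u - (t + clamp r v)|))//.
  by rewrite ler_wpM2r// ler_norm.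
by rewrite ler_wpM2l// opprD addrACA subrr add0r; exact: clamp_lip.
Qed.

Lemma segC_lip k z t s : lip k z -> segC r z t s = z (t + clamp r s).
Proof.
move=> kz; rewrite /segC -[LHS]/(val _ s) insubdK//.
apply/cont_funP; split=> [u|u]; last by rewrite (clamp_id (clamp_itv r u)).
have /lip_cont_fun/cont_funP[c _] := valP (segW r z t).
rewrite (_ : (fun s => _) = segW r z t); first exact: c.
by apply/funext => v; rewrite (segW_lip _ _ kz).
Qed.

Lemma clamp0 : clamp r 0 = 0.
Proof. by rewrite clamp_id// in_itv/= lexx andbT oppr_le0. Qed.

Lemma segW_lip0 k z t : lip k z -> segW r z t 0 = z t.
Proof. by move=> kz; rewrite (segW_lip _ _ kz) clamp0 addr0. Qed.

Lemma W1oo_clamp (x : W) s : x s = x (clamp r s).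
Proof. by have /lip_funP[_ ->] := valP x. Qed.

Lemma segW_shift z a t :
  segW r (fun s => z (a + s)) t = segW r z (a + t).
Proof. by congr insubd; apply/funext => s; rewrite addrA. Qed.

Lemma W1oo_continuous (x : W) : continuous x.
Proof. by have /lip_cont_fun/cont_funP[] := valP x. Qed.

Lemma W1oo_lip (x : W) : exists k, 0 <= k /\ lip k x.
Proof.
have /lip_funP[[k kx] _] := valP x; exists `|k|; split=> // s t.
by rewrite (le_trans (kx s t))// ler_wpM2r// ler_norm.
Qed.

Lemma Cspace_norm_le (x : C) e :
  (forall s, s \in `[- r%:num, 0] -> `|x s| <= e) -> `|x| <= e.
Proof.
by move=> H; apply: sup_norm_le => //; have /cont_funP[] := valP x.
Qed.

Lemma W1oo_norm_ge (x : W) s : `|x s| <= `|x|.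
Proof.
rewrite W1oo_clamp [leRHS]/Num.Def.normr/= /W1oo_norm le_max.
by rewrite sup_norm_ge//; [exact: W1oo_continuous|exact: clamp_itv].
Qed.

(** A Lipschitz constant bounds the essential supremum of the derivative. Convergence in W^{1,oo} is
    thus reduced to uniform and Lipschitz estimates of differences. *)
Lemma W1oo_norm_le (x : W) e :
  (forall s, s \in `[- r%:num, 0] -> `|x s| <= e) -> lip e x -> `|x| <= e.
Proof.
move=> H ex; rewrite [leLHS]/Num.Def.normr/= /W1oo_norm ge_max.
rewrite sup_norm_le//=; last exact: W1oo_continuous.
have fx := deriv_norm_fin (valP x).
by have := deriv_norm_lip_le (valP x) ex; rewrite -(fineK fx) lee_fin.
Qed.

Lemma CspaceB (x y : C) s : (x - y : C) s = x s - y s.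
Proof. by []. Qed.

Lemma W1ooB (x y : W) s : (x - y : W) s = x s - y s.
Proof. by []. Qed.

End segments.

Lemma cvg_pair_nbhs (T : Type) (U U' : topologicalType) (G : set_system T)
    (f : T -> U) (g : T -> U') (u : U) (u' : U') : Filter G ->
  f t @[t --> G] --> u -> g t @[t --> G] --> u' ->
  (f t, g t) @[t --> G] --> (u, u').
Proof. by move=> FG fu gu; exact: cvg_pair. Qed.

(** * Limits of equi-Lipschitz families *)

Section limits.
Context (R : realType) (r : {posnum R}) (n : nat) (I : Type).
Local Notation V := 'rV[R]_n.
Variables (G : set_system I) (zi : I -> R -> V) (z : R -> V) (k : R).
Hypothesis kzi : \forall i \near G, lip k (zi i).
Hypothesis cvgz : forall t, zi i t @[i --> G] --> z t.

Lemma lim_lip : ProperFilter G -> lip k z.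
Proof.
move=> FG s t.
have L : `|zi i s - zi i t| @[i --> G] --> `|z s - z t|.
  by apply: cvg_norm; apply: cvgB; exact: cvgz.
rewrite -(cvg_lim _ L)//; apply: limr_le; first by apply/cvg_ex; eexists; exact: L.
by apply: filterS kzi => i; exact.
Qed.

Lemma lim_bound M : ProperFilter G ->
  (\forall i \near G, forall t, `|zi i t| <= M) -> forall t, `|z t| <= M.
Proof.
move=> FG ziM t.
have L : `|zi i t| @[i --> G] --> `|z t| by apply: cvg_norm; exact: cvgz.
rewrite -(cvg_lim _ L)//; apply: limr_le; first by apply/cvg_ex; eexists; exact: L.
by apply: filterS ziM => i; exact.
Qed.

(** A common Lipschitz constant turns pointwise convergence into joint convergence in time and
    index; compactness of the interval makes it uniform. *)
Lemma lim_unif a b e : Filter G -> lip k z -> 0 < e ->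
  \forall i \near G, forall t, t \in `[a, b] -> `|zi i t - z t| <= e.
Proof.
move=> FG kz e0.
have /compact_near_coveringP := @segment_compact R a b.
move=> /(_ I G (fun i t => `|zi i t - z t| <= e) FG); apply => t _.
have zit : zi p.2 p.1 @[p --> filter_prod (nbhs t) G] --> z t.
  apply: (@lip_cvg _ _ k z (R * I) (filter_prod (nbhs t) G) _ (fun p => zi p.2)).
  - by apply: cvg_snd kzi.
  - by apply: (@cvg_comp _ _ _ snd (fun i => zi i t) _ G); [exact: cvg_snd|exact: cvgz].
  - exact: cvg_fst.
have zt : z p.1 @[p --> filter_prod (nbhs t) G] --> z t.
  by apply: (@cvg_comp _ _ _ fst z _ (nbhs t)); [exact: cvg_fst|exact: lip_continuous kz _].
have : zi p.2 p.1 - z p.1 @[p --> filter_prod (nbhs t) G] --> z t - z t.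
  by apply: cvgB zit zt.
move=> /cvgrPdist_le /(_ e e0).
by apply: filterS => -[u i] /=; rewrite subrr sub0r normrN.
Qed.

Lemma segC_cvg (ti : I -> R) t : Filter G -> lip k z -> ti i @[i --> G] --> t ->
  segC r (zi i) (ti i) @[i --> G] --> segC r z t.
Proof.
move=> FG kz tit; apply/cvgrPdist_le => e e0.
have e2 : 0 < e / 2 by rewrite divr_gt0.
have k1 : 0 < `|k| + 1 by rewrite ltr_wpDl.
near=> i.
have kz' : lip k (zi i) by near: i.
apply: Cspace_norm_le => s sI.
rewrite CspaceB (segC_lip _ _ _ kz) (segC_lip _ _ _ kz') clamp_id//.
rewrite -(subrKA (zi i (t + s))) (le_trans (ler_normD _ _))// (splitr e) lerD//.
  rewrite distrC.
  have : t + s \in `[t - r%:num, t].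
    by move: sI; rewrite !in_itv/= => /andP[s1 s2]; rewrite lerD2l s1/= gerDl.
  by move: (t + s); near: i; exact: lim_unif.
rewrite (le_trans (kz' _ _))// (@le_trans _ _ ((`|k| + 1) * `|t - ti i|))//.
  rewrite [X in `|X|](_ : _ = t - ti i); last by lra.
  by rewrite ler_wpM2r// (le_trans (ler_norm _))// lerDl.
rewrite mulrC -ler_pdivlMr//.
near: i; apply: (@cvgr_dist_le _ R^o _ G _ ti) => //.
by rewrite divr_gt0.
Unshelve. all: by end_near. Qed.

Context (Omega : metricType R) (sigma : R -> Omega -> Omega).
Hypothesis sigma_flow : continuous_flow sigma.
Variables (F : Omega * V * V -> V) (tau : Omega * Cspace r n -> R).
Hypotheses (F_cont : continuous F) (tau_cont : continuous tau).
Variables (wi : I -> Omega) (w : Omega).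
Hypothesis cvgw : wi i @[i --> G] --> w.

(** The delayed argument moves with [i], which [lip_cvg] absorbs. The moving time [ti] makes the
    lemma usable on product filters and, with constant families, for continuity in [t]. *)
Lemma rhs_cvg (ti : I -> R) t : Filter G -> lip k z -> ti i @[i --> G] --> t ->
  rhs sigma F tau (wi i) (zi i) (ti i) @[i --> G] --> rhs sigma F tau w z t.
Proof.
move=> FG kz tit; have [cs _ _] := sigma_flow.
have sw : sigma (ti i) (wi i) @[i --> G] --> sigma t w.
  by apply: (continuous2_cvg FG _ tit cvgw); exact: (cs (t, w)).
have st : tau (sigma (ti i) (wi i), segC r (zi i) (ti i)) @[i --> G] -->
    tau (sigma t w, segC r z t).
  apply: (continuous_cvg FG (@tau_cont (sigma t w, segC r z t))).
  by apply: cvg_pair_nbhs sw _; exact: segC_cvg.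
have zt := @lip_cvg _ _ k z I G FG zi ti t kzi (@cvgz t) tit.
have zd : zi i (ti i - tau (sigma (ti i) (wi i), segC r (zi i) (ti i)))
    @[i --> G] --> z (t - tau (sigma t w, segC r z t)).
  apply: (@lip_cvg _ _ k z I G FG zi _ _ kzi (@cvgz _)).
  by apply: (@cvgB _ R^o).
exact: (continuous_cvg FG (@F_cont (_, _, _)) (cvg_pair_nbhs FG (cvg_pair_nbhs FG sw zt) zd)).
Qed.

End limits.

(** * Trajectories, their translates and their limits *)

Section trajectories.
Context (R : realType) (r : {posnum R}) (n : nat) (Omega : metricType R).
Local Notation V := 'rV[R]_n.
Local Notation C := (Cspace r n).
Local Notation W := (W1oo r n).
Context (sigma : R -> Omega -> Omega) (sigma_flow : continuous_flow sigma).
Context (F : Omega * V * V -> V) (tau : Omega * C -> R).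
Context (F_cont : continuous F) (tau_cont : continuous tau).
Context (tau_range : forall p, 0 <= tau p <= r%:num).
Local Notation rhs := (rhs sigma F tau).
Implicit Types (w : Omega) (z : R -> V) (a b k M : R).

Definition traj w z a b := has_rate z (rhs w z) a b.

Lemma rhs_continuous w z k : lip k z -> continuous (rhs w z).
Proof.
move=> kz t.
apply: (@rhs_cvg R r n R (nbhs t) (fun=> z) z k _ _ Omega sigma sigma_flow F tau
  F_cont tau_cont (fun=> w) w _ id t) => //; try by move=> *; exact: cvg_cst.
exact: nearW.
Qed.

Lemma eq_rhs w (y z : R -> V) t :
  (forall s, t - r%:num <= s <= t -> y s = z s) -> rhs w y t = rhs w z t.
Proof.
move=> yz; rewrite /Defs.rhs (eq_segC yz) yz ?lexx ?andbT ?gerBl//.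
rewrite yz//; have /andP[t1 t2] := tau_range (sigma t w, segC r z t).
by rewrite lerB//= gerBl.
Qed.

Lemma eq_traj w (y z : R -> V) a b :
  (forall s, a - r%:num <= s <= b -> y s = z s) -> traj w y a b -> traj w z a b.
Proof.
move=> yz; apply: eq_has_rate => t at_ tb; split.
  by rewrite yz// tb andbT lerBlDr (le_trans at_)// lerDl.
apply/esym/eq_rhs => s /andP[s1 s2]; apply: yz.
by rewrite (le_trans s2)// andbT (le_trans _ s1)// lerB.
Qed.

(** The equation is autonomous for the skew product: a shift of time is a motion of the base point
    along the flow. *)
Lemma rhs_shift w z a t :
  rhs (sigma a w) (fun s => z (a + s)) t = rhs w z (a + t).
Proof.
have [_ _ sD] := sigma_flow.
have E : segC r (fun s => z (a + s)) t = segC r z (a + t).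
  by congr insubd; apply/funext => s; rewrite addrA.
by rewrite /Defs.rhs E -sD (addrC t) addrA.
Qed.

Lemma traj_shift w z a b c : traj w z b c ->
  traj (sigma a w) (fun s => z (a + s)) (b - a) (c - a).
Proof.
move=> /has_rate_shift-/(_ a); apply: eq_has_rate => t _ _; split=> //.
exact: rhs_shift.
Qed.

Section limit.
Context (I : Type) (G : set_system I) (FG : ProperFilter G).
Context (zi : I -> R -> V) (z : R -> V) (k : R) (wi : I -> Omega) (w : Omega).
Hypothesis kzi : \forall i \near G, lip k (zi i).
Hypothesis cvgz : forall t, zi i t @[i --> G] --> z t.
Hypothesis cvgw : wi i @[i --> G] --> w.

Let kz : lip k z := lim_lip kzi cvgz FG.

(** The covering argument of [lim_unif] for the right-hand sides, that is, for the derivatives. *)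
Lemma rhs_unif a b e : 0 < e ->
  \forall i \near G, forall t, t \in `[a, b] ->
    `|rhs (wi i) (zi i) t - rhs w z t| <= e.
Proof.
move=> e0; have /compact_near_coveringP := @segment_compact R a b.
move=> /(_ I G (fun i t => `|rhs (wi i) (zi i) t - rhs w z t| <= e) _).
apply => t _.
have rit : rhs (wi p.2) (zi p.2) p.1 @[p --> filter_prod (nbhs t) G] --> rhs w z t.
  apply: (@rhs_cvg R r n (R * I)%type (filter_prod (nbhs t) G) (fun p => zi p.2) z k _ _
    Omega sigma sigma_flow F tau F_cont tau_cont (fun p => wi p.2) w _ fst t) => //.
  - by apply: cvg_snd kzi.
  - move=> s; apply: (@cvg_comp _ _ _ snd (fun i => zi i s) _ G).
      exact: cvg_snd.
    exact: cvgz.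
  - by apply: (@cvg_comp _ _ _ snd wi _ G); [exact: cvg_snd|exact: cvgw].
  - exact: cvg_fst.
have rt : rhs w z p.1 @[p --> filter_prod (nbhs t) G] --> rhs w z t.
  apply: (@cvg_comp _ _ _ fst (rhs w z) _ (nbhs t)); first exact: cvg_fst.
  exact: rhs_continuous kz _.
have : rhs (wi p.2) (zi p.2) p.1 - rhs w z p.1
    @[p --> filter_prod (nbhs t) G] --> rhs w z t - rhs w z t.
  by apply: cvgB rit rt.
move=> /cvgrPdist_le /(_ e e0).
by apply: filterS => -[u i] /=; rewrite subrr sub0r normrN.
Qed.

Lemma traj_lim a b : (\forall i \near G, traj (wi i) (zi i) a b) -> traj w z a b.
Proof.
apply: has_rate_lim cvgz _ => e e0.
apply: filterS (@rhs_unif a b e e0) => i H t at_ tb.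
by apply: H; rewrite in_itv/= at_ tb.
Qed.

(* The equation turns uniform convergence of the trajectories on [b - 2r, b]
   into uniform convergence of their derivatives on [b - r, b]. *)
Lemma segW_cvg b : (\forall i \near G, traj (wi i) (zi i) (b - r%:num) b) ->
  segW r (zi i) b @[i --> G] --> segW r z b.
Proof.
move=> tr; apply/cvgrPdist_le => e e0; near=> i.
have kz' : lip k (zi i) by near: i.
have bI s : b + clamp r s \in `[b - r%:num, b].
  have := clamp_itv r s; rewrite !in_itv/= => /andP[s1 s2].
  by rewrite lerD2l s1/= gerDl.
apply: W1oo_norm_le => [s sI|].
  rewrite W1ooB (segW_lip _ _ _ kz) (segW_lip _ _ _ kz') distrC.
  have := bI s; move: (b + _); near: i; apply: lim_unif kz e0 => //; exact: kzi.
apply: lip_le => s t st.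
have gE u : (segW r z b - segW r (zi i) b : W) u =
    z (b + clamp r u) - zi i (b + clamp r u).
  by rewrite W1ooB (segW_lip _ _ _ kz) (segW_lip _ _ _ kz').
rewrite (gE s) (gE t).
have cst : clamp r s <= clamp r t.
  by rewrite /clamp /Num.max /Num.min; do ![case: ifPn]; rewrite -?leNgt; lra.
(* Since [clamp] is 1-Lipschitz, it suffices to compare with the clamped increment, where both times
   lie in [b - r, b] and the equation holds. *)
apply: le_trans (_ : e * (b + clamp r t - (b + clamp r s)) <= _); last first.
  rewrite ler_wpM2l ?(ltW e0)// opprD addrACA subrr add0r.
  by have := clamp_lip r t s; rewrite !ger0_norm ?subr_ge0.
have trz : traj w z (b - r%:num) b by exact: traj_lim.
have tri : traj (wi i) (zi i) (b - r%:num) b by near: i.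
have dist : forall u, u \in `[b - r%:num, b] -> `|rhs (wi i) (zi i) u - rhs w z u| <= e.
  by near: i; exact: rhs_unif.
apply: (has_rate_diff (lip_continuous kz) (lip_continuous kz')
  (rhs_continuous kz) (rhs_continuous kz') trz tri).
- by move=> u u1 u2; rewrite distrC dist// in_itv/= u1 u2.
- by have := bI s; rewrite in_itv/= => /andP[].
- by rewrite lerD2l.
- by have := bI t; rewrite in_itv/= => /andP[].
Unshelve. all: by end_near. Qed.

End limit.

End trajectories.

(** A cluster point of an ultrafilter is a limit: the ultrafilter contains each neighbourhood or its
    complement, and clustering excludes the complement. *)
Lemma ultra_cvg_compact (I : Type) (T : topologicalType) (G : set_system I)
    (K : set T) (f : I -> T) : UltraFilter G -> compact K ->
  (\forall i \near G, K (f i)) -> exists2 p, K p & f i @[i --> G] --> p.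
Proof.
move=> UG cK GK; have [p [Kp clp]] := cK (f @ G) _ GK.
exists p => // A pA; have [//|nA] := in_ultra_setVsetC (f @^-1` A) UG.
by have [t [nAt At]] := clp (~` A) A nA pA.
Qed.

(** * Solutions as trajectories, with their bounds *)

Section solutions.
Context (R : realType) (r : {posnum R}) (n : nat) (Omega : metricType R).
Local Notation V := 'rV[R]_n.
Local Notation C := (Cspace r n).
Local Notation W := (W1oo r n).
Context (Omega_compact : compact [set: Omega]).
Context (sigma : R -> Omega -> Omega) (sigma_flow : continuous_flow sigma).
Context (F : Omega * V * V -> V) (tau : Omega * C -> R).
Context (F_cont : continuous F) (tau_cont : continuous tau).
Context (tau_range : forall p, 0 <= tau p <= r%:num).
Local Notation rhs := (rhs sigma F tau).
Local Notation traj := (traj sigma F tau).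
Local Notation is_solution := (is_solution sigma F tau).
Implicit Types (w : Omega) (x : W) (z : R -> V) (a b k L M T : R).

Lemma compact_cball M : compact [set u : V | `|u| <= M].
Proof.
apply: bounded_closed_compact.
  exists M; split; first exact: num_real.
  by move=> N MN u /= /le_trans; apply; exact: ltW.
apply: (@closed_comp _ _ (fun u : V => `|u|) [set t : R | t <= M]).
  by move=> u _; exact: norm_continuous.
exact: closed_le.
Qed.

Definition F_bound M L := forall w (u v : V),
  `|u| <= M -> `|v| <= M -> `|F (w, u, v)| <= L.

Lemma F_boundP M : exists2 L, 0 <= L & F_bound M L.
Proof.
have cB := @compact_cball M.
have cK := compact_setX (compact_setX Omega_compact cB) cB.
have := continuous_compact (continuous_subspaceT F_cont) cK.
move=> /compact_bounded[L [_ H]].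
exists (`|L| + 1); first by rewrite addr_ge0.
move=> w u v uM vM; apply: (H (`|L| + 1)).
  by rewrite (le_lt_trans (ler_norm _))// ltrDl.
by exists (w, u, v).
Qed.

Lemma rhs_bound M L w z t : F_bound M L ->
  (forall s, t - r%:num <= s <= t -> `|z s| <= M) -> `|rhs w z t| <= L.
Proof.
move=> FL zM; apply: FL; apply: zM; first by rewrite lexx andbT gerBl.
have /andP[t1 t2] := tau_range (sigma t w, segC r z t).
by rewrite lerB//= gerBl.
Qed.

(** The mean value inequality with [c = 0]. The constant depends on [F] and [M] only, not on the
    trajectory. *)
Lemma traj_lip M L w z a b : F_bound M L ->
  (forall s, a - r%:num <= s <= b -> `|z s| <= M) -> traj w z a b ->
  forall s t, a <= s -> s <= t -> t <= b -> `|z t - z s| <= L * (t - s).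
Proof.
move=> FL zM tr s t as_ st tb.
have := tr s t as_ st tb 0 L; rewrite scaler0 subr0; apply => u su ut.
rewrite subr0; apply: rhs_bound FL _ => v /andP[v1 v2]; apply: zM.
rewrite (le_trans v2) ?(le_trans ut)// andbT (le_trans _ v1)//.
by rewrite lerB// (le_trans as_).
Qed.

Section one_solution.
Context (w : Omega) (x : W) (b : \bar R) (y : R -> V).
Hypothesis sol : is_solution w x b y.

Lemma sol_continuous T : (T%:E < b)%E -> {within `[- r%:num, T], continuous y}.
Proof.
have [_ _ cy _] := sol => Tb; apply: continuous_subspaceW cy => s /=.
by rewrite in_itv/= => /andP[-> sT]; split=> //; rewrite (le_lt_trans _ Tb)// lee_fin.
Qed.

Lemma sol_traj T : (T%:E < b)%E -> traj w y 0 T.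
Proof.
move=> Tb; have [_ _ _ dy] := sol; apply: derive_has_rate.
  apply: continuous_subspaceW (sol_continuous Tb) => s /=.
  by rewrite !in_itv/= => /andP[s0 ->]; rewrite andbT (le_trans _ s0)// oppr_le0.
move=> t /andP[t0 tT].
apply: (@cvg_withinP _ _ _ [set h | 0 <= t + h]); last first.
  by apply: dy; [exact: ltW|rewrite (lt_trans _ Tb)// lte_fin].
near=> h; have : `|h| <= t by near: h; exact: dnbhs0_le.
by rewrite ler_norml /= => /andP[]; lra.
Unshelve. all: by end_near. Qed.

Lemma sol_bounded T : (T%:E < b)%E ->
  exists M, forall s, - r%:num <= s <= T -> `|y s| <= M.
Proof.
move=> /sol_continuous cy.
have := continuous_compact cy (@segment_compact _ _ _).
move=> /compact_bounded[M [_ H]]; exists (`|M| + 1) => s sT.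
apply: (H (`|M| + 1)); first by rewrite (le_lt_trans (ler_norm _))// ltrDl.
by exists s => //=; rewrite in_itv.
Qed.

Lemma sol_init s : - r%:num <= s <= 0 -> y s = x s.
Proof. by have [_ yx _ _] := sol => sI; apply: yx; rewrite in_itv. Qed.

Lemma sol_segW0 : segW r y 0 = x.
Proof.
have [k [_ kx]] := W1oo_lip x.
rewrite (@eq_segW _ _ _ _ x) => [|s]; last by rewrite sub0r => /sol_init.
apply/val_inj/funext => s; rewrite [LHS](segW_lip _ _ _ kx) add0r.
by rewrite -W1oo_clamp.
Qed.

(** [k] is the larger of the Lipschitz constant of [x], for [-r, 0], and [L], for later times. It is
    chosen before [T], so it survives when [T] tends to the end of the interval of existence. *)
Lemma sol_lip M L : F_bound M L -> 0 <= L ->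
  exists2 k, 0 <= k & forall T, (T%:E < b)%E ->
    (forall s, - r%:num <= s <= T -> `|y s| <= M) ->
    forall s t, - r%:num <= s -> s <= t -> t <= T -> `|y t - y s| <= k * (t - s).
Proof.
move=> FL L0; have [k [k0 kx]] := W1oo_lip x.
exists (Num.max k L); first by rewrite le_max k0.
move=> T Tb yM.
have yk s t : - r%:num <= s -> s <= t -> t <= 0 ->
    `|y t - y s| <= Num.max k L * (t - s).
  move=> s1 st t0; rewrite !sol_init ?s1 ?t0 ?(le_trans st)// ?(le_trans s1)//.
  have := kx t s; rewrite (ger0_norm (_ : 0 <= t - s)) ?subr_ge0// => /le_trans; apply.
  by rewrite ler_wpM2r ?subr_ge0// le_max lexx.
have yL s t : 0 <= s -> s <= t -> t <= T -> `|y t - y s| <= Num.max k L * (t - s).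
  move=> s0 st tT.
  have := traj_lip FL _ (sol_traj Tb) s0 st tT; rewrite sub0r => /(_ yM) /le_trans; apply.
  by rewrite ler_wpM2r ?subr_ge0// le_max lexx orbT.
move=> s t s1 st tT; have [t0|/ltW t0] := leP t 0; first exact: yk.
have [s0|/ltW s0] := leP 0 s; first exact: yL.
rewrite -(subrKA (y 0)) (le_trans (ler_normD _ _))//.
have := yk _ _ s1 s0 (lexx 0); have := yL _ _ (lexx 0) t0 tT; lra.
Qed.

End one_solution.

(** Constant continuation outside [a, b]: it makes a solution known on an interval Lipschitz on all
    of R, as [lip] demands. *)
Definition clip a b (y : R -> V) (s : R) := y (Num.max a (Num.min s b)).

Lemma clip_id a b (y : R -> V) s : a <= s <= b -> clip a b y s = y s.
Proof. by move=> /andP[s1 s2]; rewrite /clip min_l// max_r. Qed.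

Lemma clip_itv a b s : a <= b -> a <= Num.max a (Num.min s b) <= b.
Proof. by move=> ab; rewrite le_max lexx/= ge_max ab ge_min lexx orbT. Qed.

Lemma clip_lip a b k y : a <= b -> 0 <= k ->
  (forall s t, a <= s -> s <= t -> t <= b -> `|y t - y s| <= k * (t - s)) ->
  lip k (clip a b y).
Proof.
move=> ab k0 ky; apply: lip_le => s t st; rewrite /clip.
have /andP[s1 s2] := clip_itv s ab; have /andP[t1 t2] := clip_itv t ab.
have st' : Num.max a (Num.min s b) <= Num.max a (Num.min t b).
  by rewrite ge_max le_max lexx/= le_max le_min !ge_min st lexx !orbT.
apply: le_trans (ky _ _ s1 st' t2) _; rewrite ler_wpM2l//.
rewrite lerBlDr ge_max; apply/andP; split.
  by rewrite -[leLHS]add0r lerD ?subr_ge0// le_max lexx.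
apply: le_trans (_ : t - s + Num.min s b <= _); last by rewrite lerD2l le_max lexx orbT.
by rewrite /Num.min; do ![case: ifPn]; rewrite -?leNgt; lra.
Qed.

Lemma sol_segW_lip w x (b : \bar R) y t : is_solution w x b y -> 0 <= t -> (t%:E < b)%E ->
  exists k, lip k (clip (- r%:num) t y).
Proof.
move=> sol t0 tb; have [M yM] := sol_bounded sol tb.
have [L L0 FL] := F_boundP M.
have [k k0 kP] := sol_lip sol FL L0.
exists k; apply: clip_lip => //; last exact: kP.
by rewrite (le_trans _ t0)// oppr_le0.
Qed.

Lemma clip_segW a t y : a <= t - r%:num -> segW r y t = segW r (clip a t y) t.
Proof.
move=> at_; apply: eq_segW => s /andP[s1 s2].
by rewrite clip_id// s2 (le_trans at_).
Qed.

(** [segW] would return 0 on a segment that is not Lipschitz, so the proof passes through [clip],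
    where Lipschitz continuity is known. *)
Lemma sol_val_le w x (b : \bar R) y t : is_solution w x b y -> 0 <= t -> (t%:E < b)%E ->
  `|y t| <= `|segW r y t|.
Proof.
move=> sol t0 tb; have [k kz] := sol_segW_lip sol t0 tb.
rewrite (@clip_segW (- r%:num)); last by rewrite lerBrDr addNr.
rewrite (le_trans _ (W1oo_norm_ge _ 0))// (segW_lip0 _ _ kz) clip_id//.
by rewrite lexx andbT (le_trans _ t0)// oppr_le0.
Qed.

Lemma sol_bound w x (b : \bar R) y M : is_solution w x b y ->
  (forall t, 0 <= t -> (t%:E < b)%E -> `|segW r y t| <= M) ->
  forall t, - r%:num <= t -> (t%:E < b)%E -> `|y t| <= M.
Proof.
move=> sol yM t t1 tb; have [t0|/ltW t0] := leP 0 t.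
  exact: le_trans (sol_val_le sol t0 tb) (yM _ t0 tb).
rewrite (sol_init sol) ?t1// (le_trans (W1oo_norm_ge _ _))//.
by rewrite -(sol_segW0 sol) yM//; case: sol.
Qed.

Lemma lt_ereal_real (t : R) (b : \bar R) : (t%:E < b)%E ->
  exists2 T : R, t < T & (T%:E < b)%E.
Proof.
case: b => [b|_|//]; last by exists (t + 1); rewrite ?ltry// ltrDl.
by rewrite lte_fin => tb; exists ((t + b) / 2); rewrite ?lte_fin !midf_lt.
Qed.

(** A converse to [sol_traj]. The derivative at [t] needs the equation slightly beyond [t], hence
    the intermediate [T]. *)
Lemma traj_sol w x (b : \bar R) z k : lip k z -> (0 < b)%E ->
  (forall s, - r%:num <= s <= 0 -> z s = x s) ->
  (forall T, (T%:E < b)%E -> traj w z 0 T) -> is_solution w x b z.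
Proof.
move=> kz b0 zx tr; split=> //.
- by apply: continuous_subspaceT; exact: lip_continuous kz.
- move=> t t0 /lt_ereal_real[T tT Tb].
  apply: has_rate_cvg (tr T Tb) _ t0 tT.
  exact: (rhs_continuous sigma_flow F_cont tau_cont kz).
Qed.

End solutions.

(** * Uniqueness, and global existence of bounded solutions *)

Section maximal_solutions.
Context (R : realType) (r : {posnum R}) (n : nat) (Omega : metricType R).
Local Notation V := 'rV[R]_n.
Local Notation C := (Cspace r n).
Local Notation W := (W1oo r n).
Context (Omega_compact : compact [set: Omega]).
Context (sigma : R -> Omega -> Omega) (sigma_flow : continuous_flow sigma).
Context (F : Omega * V * V -> V) (tau : Omega * C -> R).
Context (F_cont : continuous F) (tau_cont : continuous tau).
Context (tau_range : forall p, 0 <= tau p <= r%:num).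
Context (beta : Omega -> W -> \bar R) (y : Omega -> W -> R -> V).
Context (y_max : forall w x,
  is_maximal_solution sigma F tau w x (beta w x) (y w x)).
Local Notation traj := (traj sigma F tau).
Local Notation semiflow := (semiflow sigma y).
Implicit Types (w : Omega) (x : W) (z : R -> V) (a b k L M T : R).

Let y_sol w x : is_solution sigma F tau w x (beta w x) (y w x).
Proof. by case: (y_max w x). Qed.

(** [z] is a solution with right end [+oo]: maximality forces [beta w x] to be infinite and
    uniqueness identifies the two functions. *)
Lemma traj_max w z k : lip k z -> (forall T, traj w z 0 T) ->
  let x := segW r z 0 in
  [/\ beta w x = +oo%E, forall t, - r%:num <= t -> y w x t = z t &
      forall t, 0 <= t -> semiflow t (w, x) = (sigma t w, segW r z t)].
Proof.
move=> kz tr x.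
have zx s : - r%:num <= s <= 0 -> z s = x s.
  by move=> sI; rewrite /x (segW_lip _ _ _ kz) add0r clamp_id// in_itv.
have sol : is_solution sigma F tau w x +oo%E z by apply: traj_sol kz _ zx _.
have [_ /(_ _ _ sol)[]] := y_max w x; rewrite leye_eq => /eqP b_oo zy.
have yz t : - r%:num <= t -> y w x t = z t by move=> t1; rewrite zy ?ltry.
split=> // t t0; congr pair; apply: eq_segW => s /andP[s1 _].
by apply: yz; rewrite (le_trans _ s1)// lerBrDr addNr.
Qed.

Lemma global_traj w x M L : F_bound F M L -> 0 <= L -> beta w x = +oo%E ->
  (forall t, 0 <= t -> `|segW r (y w x) t| <= M) ->
  exists k z, [/\ lip k z, segW r z 0 = x, forall T, traj w z 0 T &
    forall t, `|z t| <= M].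
Proof.
move=> FL L0 boo yM; have sol := y_sol w x.
have yM' t : - r%:num <= t -> `|y w x t| <= M.
  move=> t1; apply: (sol_bound Omega_compact F_cont tau_range sol) => //.
    by move=> s s0 _; exact: yM.
  by rewrite boo ltry.
have [k k0 kP] := sol_lip tau_range sol FL L0.
(* Constant before -r, where nothing is known about [y w x]. *)
pose z s := y w x (Num.max (- r%:num) s).
have zE s : - r%:num <= s -> z s = y w x s by move=> s1; rewrite /z max_r.
have kz : lip k z.
  apply: (@lip_glue _ _ _ (- r%:num)) => s t.
    move=> st tr; rewrite /z !max_l// ?(le_trans st)// subrr normr0.
    by rewrite mulr_ge0// subr_ge0.
  move=> s1 st; rewrite !zE ?(le_trans s1)//; apply: (kP t) => //; first by rewrite boo ltry.
  by move=> u /andP[u1 _]; exact: yM'.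
exists k, z; split=> //.
- rewrite -[RHS](sol_segW0 sol); apply: eq_segW => s /andP[s1 _].
  by rewrite zE// -sub0r.
- move=> T; apply: (eq_traj tau_range _ (sol_traj sol _)); last by rewrite boo ltry.
  by move=> s /andP[s1 _]; rewrite zE// -sub0r.
- by move=> t; apply: yM'; rewrite le_max lexx.
Qed.

(* At a finite right end b the bounded solution is Lipschitz, hence extends to b,
   where it can be continued by the maximal solution through its segment at b. *)
Lemma bounded_beta w x M :
  (forall t, 0 <= t -> (t%:E < beta w x)%E -> `|segW r (y w x) t| <= M) ->
  beta w x = +oo%E.
Proof.
move=> yM; have sol := y_sol w x.
have yM' := sol_bound Omega_compact F_cont tau_range sol yM.
have [L L0 FL] := F_boundP Omega_compact F_cont M.
have [k k0 kP] := sol_lip tau_range sol FL L0.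
have b0 : (0 < beta w x)%E by case: sol.
case Eb : (beta w x) => [b| |]; [|by []|by move: b0; rewrite Eb].
have {}b0 : 0 < b by move: b0; rewrite Eb lte_fin.
pose zi T := clip (- r%:num) T (y w x).
have nr0 : - r%:num <= 0 by rewrite oppr_le0.
(* The truncations at [T] are followed as [T] tends to [b] from the left. At each [s] in [-r, b)
   they eventually equal [y w x s], so their limit continues the solution to [b]. *)
have [G [UG sG]] := @ultraFilterLemma _ (b^'-) _.
have kzi : \forall T \near G, lip k (zi T).
  apply: sG; near=> T; have Tb : T < b by near: T; exact: nbhs_left_lt.
  have T0 : 0 < T by near: T; exact: nbhs_left_gt.
  apply: clip_lip => //; first by rewrite (le_trans nr0)// ltW.
  apply: kP; first by rewrite Eb lte_fin.
  by move=> s /andP[s1 s2]; apply: yM' => //; rewrite Eb lte_fin (le_lt_trans s2).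
have /choice[z cz] : forall t, exists p : V, zi T t @[T --> G] --> p.
  move=> t; have [|p _ ?] := @ultra_cvg_compact _ _ G _ (fun T => zi T t) UG
    (@compact_cball R n M); last by exists p.
  apply: sG; near=> T; have Tb : T < b by near: T; exact: nbhs_left_lt.
  have T0 : 0 < T by near: T; exact: nbhs_left_gt.
  have /andP[t1 t2] := clip_itv t (le_trans nr0 (ltW T0)).
  by apply: yM' => //; rewrite Eb lte_fin (le_lt_trans t2).
have kz : lip k z by exact: lim_lip kzi cz _.
have zE s : - r%:num <= s < b -> z s = y w x s.
  move=> /andP[s1 sb]; rewrite -(cvg_lim (@norm_hausdorff _ _) (@cz s)).
  apply: cvg_lim => //; apply: cvg_near_cst; apply: sG; near=> T.
  by rewrite /zi clip_id// s1/=; near: T; exact: nbhs_left_ge.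
have trz : traj w z 0 b.
  apply: has_rate_closed => //; first exact: lip_continuous kz.
  move=> T Tb; apply: (eq_traj tau_range _ (sol_traj sol _)); last by rewrite Eb lte_fin.
  by move=> s /andP[s1 s2]; rewrite zE// -sub0r s1/= (le_lt_trans s2).
pose x' := segW r z b; pose w' := sigma b w.
have sol' := y_sol w' x'.
have [T' T'0 T'b] : exists2 T : R, 0 < T & (T%:E < beta w' x')%E.
  by apply: lt_ereal_real; case: sol'.
have [k' kz'] := sol_segW_lip Omega_compact F_cont tau_range sol' (ltW T'0) T'b.
pose z' := clip (- r%:num) T' (y w' x').
have z'z s : - r%:num <= s <= 0 -> z' s = z (b + s).
  move=> /andP[s1 s2]; rewrite /z' clip_id ?s1 ?(le_trans s2 (ltW T'0))//.
  rewrite (sol_init sol') ?s1// /x' (segW_lip _ _ _ kz) clamp_id//.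
  by rewrite in_itv/= s1.
(* [z] and [z'] overlap on [b - r, b], so from b - r on [Z] is a translate of [z']. As the equation
   looks back at most [r], [Z] solves it on both sides of [b]. *)
pose Z s := if s <= b then z s else z' (s - b).
have Zr s : b - r%:num <= s -> Z s = z' (s - b).
  rewrite /Z; case: (leP s b) => // sb s1.
  have sI : - r%:num <= s - b <= 0 by apply/andP; split; lra.
  by rewrite z'z// [b + _]addrC subrK.
have Zl s : s <= b -> Z s = z s by rewrite /Z => ->.
have kZ : lip (Num.max k k') Z.
  apply: (@lip_glue _ _ _ b) => s t st.
    move=> tb; rewrite !Zl ?(le_trans st)//.
    have := kz t s; rewrite (ger0_norm (_ : 0 <= t - s)) ?subr_ge0// => /le_trans; apply.
    by rewrite ler_wpM2r ?subr_ge0// le_max lexx.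
  move=> tb; have brs : b - r%:num <= s by rewrite (le_trans _ st)// gerBl.
  rewrite !Zr// ?(le_trans brs)//.
  have := kz' (t - b) (s - b); rewrite opprB addrA subrK.
  rewrite (ger0_norm (_ : 0 <= t - s)) ?subr_ge0// => /le_trans; apply.
  by rewrite ler_wpM2r ?subr_ge0// le_max lexx orbT.
have trZ : traj w Z 0 (b + T').
  apply: (@has_rate_glue _ _ _ _ _ b).
    by apply: (eq_traj tau_range _ trz) => s /andP[_ sb]; rewrite Zl.
  have trz' : traj w' z' 0 T'.
    apply: (eq_traj tau_range _ (sol_traj sol' T'b)) => s /andP[s1 s2].
    by rewrite /z' clip_id// -sub0r s1.
  have := @traj_shift _ _ _ _ _ sigma_flow _ _ _ _ (- b) _ _ trz'.
  have [_ s0 sD] := sigma_flow.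
  rewrite /w' -sD addNr s0 !opprK add0r addrC.
  apply: (eq_traj tau_range) => s /andP[s1 _].
  by rewrite Zr// addrC.
have solZ : is_solution sigma F tau w x (b + T')%:E Z.
  apply: (traj_sol sigma_flow F_cont tau_cont kZ).
  - by rewrite lte_fin addr_gt0.
  - move=> s /andP[s1 s2]; rewrite Zl ?(le_trans s2 (ltW b0))// zE ?s1 ?(le_lt_trans s2)//.
    by rewrite (sol_init sol) ?s1.
  - by move=> T; rewrite lte_fin => /ltW Tb; exact: has_rate_sub trZ.
have [_ /(_ _ _ solZ)[]] := y_max w x.
by rewrite Eb lee_fin gerDl leNgt T'0.
Unshelve. all: by end_near. Qed.

End maximal_solutions.

Lemma hausdorff_prod (T U : topologicalType) :
  hausdorff_space T -> hausdorff_space U -> hausdorff_space (T * U)%type.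
Proof.
move=> hT hU [t u] [t' u'] cl; congr pair.
  apply: hT => A B tA tB.
  have [] := cl (fst @^-1` A) (fst @^-1` B) _ _; try exact: cvg_fst.
  by move=> x [? ?]; exists x.1.
apply: hU => A B tA tB.
have [] := cl (snd @^-1` A) (snd @^-1` B) _ _; try exact: cvg_snd.
by move=> x [? ?]; exists x.2.
Qed.

Lemma closure_ultra (T : topologicalType) (A : set T) (p : T) : closure A p ->
  exists G : set_system T, [/\ UltraFilter G, G A & G --> p].
Proof.
move=> clA.
have [G [UG sG]] := @ultraFilterLemma _ _ (within_nbhs_proper clA).
exists G; split; [exact: UG|by apply: sG; exact: withinT|].
by apply: cvg_trans sG _; exact: cvg_within.
Qed.

(** * Compactness, closures and backward extensions for the semiflow *)

Section semiflow_sets.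
Context (R : realType) (r : {posnum R}) (n : nat) (Omega : metricType R).
Local Notation V := 'rV[R]_n.
Local Notation C := (Cspace r n).
Local Notation W := (W1oo r n).
Context (Omega_compact : compact [set: Omega]).
Context (sigma : R -> Omega -> Omega) (sigma_flow : continuous_flow sigma).
Context (F : Omega * V * V -> V) (tau : Omega * C -> R).
Context (F_cont : continuous F) (tau_cont : continuous tau).
Context (tau_range : forall p, 0 <= tau p <= r%:num).
Context (beta : Omega -> W -> \bar R) (y : Omega -> W -> R -> V).
Context (y_max : forall w x,
  is_maximal_solution sigma F tau w x (beta w x) (y w x)).
Local Notation traj := (traj sigma F tau).
Local Notation semiflow := (semiflow sigma y).
Local Notation pos_invariant := (pos_invariant sigma beta y).
Local Notation backward_extension := (backward_extension sigma y).
Local Notation omega_limit := (omega_limit sigma y).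
Implicit Types (w : Omega) (x : W) (z : R -> V) (a b k L M T s t : R).
Implicit Types (p q : Omega * W) (K : set (Omega * W)).

Let hausdorff_OW : hausdorff_space (Omega * W)%type.
Proof. by apply: hausdorff_prod; [exact: metric_hausdorff|exact: norm_hausdorff]. Qed.

Let sigma0 w : sigma 0 w = w.
Proof. by case: sigma_flow. Qed.

Let sigmaD s t w : sigma (s + t) w = sigma s (sigma t w).
Proof. by case: sigma_flow. Qed.

Lemma sigma_cvg (I : Type) (G : set_system I) (wi : I -> Omega) w b : Filter G ->
  wi i @[i --> G] --> w -> sigma b (wi i) @[i --> G] --> sigma b w.
Proof.
move=> FG wiw; have [cs _ _] := sigma_flow.
by apply: (continuous2_cvg FG _ (cvg_cst b) wiw); exact: (cs (b, w)).
Qed.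

(** The interval on which the equation holds is left to each application: [-r, 0] for windows,
    [-r, T] for closures of images, any bounded interval for entire trajectories. *)
Lemma limit_traj (I : Type) (G : set_system I) (wi : I -> Omega)
    (zi : I -> R -> V) w k M : UltraFilter G ->
  (\forall i \near G, lip k (zi i)) ->
  (\forall i \near G, forall t, `|zi i t| <= M) ->
  wi i @[i --> G] --> w ->
  exists z, [/\ lip k z, forall t, `|z t| <= M,
    forall a b, (\forall i \near G, traj (wi i) (zi i) a b) -> traj w z a b &
    forall b, (\forall i \near G, traj (wi i) (zi i) (b - r%:num) b) ->
      (sigma b (wi i), segW r (zi i) b) @[i --> G] --> (sigma b w, segW r z b)].
Proof.
move=> UG kzi ziM wiw.
have /choice[z cz] : forall t, exists v : V, zi i t @[i --> G] --> v.
  move=> t; have [|v _ ?] := @ultra_cvg_compact _ _ G _ (fun i => zi i t) UG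
    (@compact_cball R n M); last by exists v.
  by apply: filterS ziM => i /= /(_ t).
exists z; split.
- exact: lim_lip kzi cz _.
- by apply: (lim_bound cz) ziM.
- by move=> a b; exact: (traj_lim sigma_flow F_cont tau_cont _ kzi cz wiw).
- move=> b tr; apply: cvg_pair_nbhs; first exact: sigma_cvg.
  exact: (segW_cvg sigma_flow F_cont tau_cont _ kzi cz wiw).
Qed.

Lemma traj_semiflow w z k a t : lip k z -> (forall T, traj w z a T) -> a <= t ->
  beta (sigma t w) (segW r z t) = +oo%E /\
  forall s, 0 <= s ->
    semiflow s (sigma t w, segW r z t) = (sigma (t + s) w, segW r z (t + s)).
Proof.
move=> kz tr at_; pose Z u := z (t + u).
have kZ : lip k Z.
  by move=> u v; rewrite (le_trans (kz _ _))// opprD addrACA subrr add0r.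
have trZ T : traj (sigma t w) Z 0 T.
  have := @traj_shift _ _ _ _ _ sigma_flow _ _ _ _ t _ _ (tr (t + T)).
  by apply: has_rate_sub; [rewrite subr_le0|rewrite addrAC subrr add0r].
have ZE u : segW r Z u = segW r z (t + u) by exact: segW_shift.
have [b_oo _ sf] := traj_max sigma_flow F_cont tau_cont y_max kZ trZ.
move: b_oo sf; rewrite /= ZE addr0 => b_oo sf; split=> // s s0.
by rewrite sf// -sigmaD addrC ZE.
Qed.

(* The Lipschitz bound also covers [-2r, -r], the past that the equation uses on
   [-r, 0]; this is what makes the derivatives there equicontinuous. *)
Definition window_set M k : set (Omega * W) :=
  [set p | exists z, [/\ lip k z, forall t, `|z t| <= M,
    traj p.1 z (- r%:num) 0 & segW r z 0 = p.2]].

(** Base points converge because [Omega] is compact, witnesses by [limit_traj]; the equation on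
    [-r, 0] is what makes the segments at 0 converge in W^{1,oo}. *)
Lemma window_compact M k : compact (window_set M k).
Proof.
rewrite compact_ultra => G UG GQ.
have [|w _ Gw] := @ultra_cvg_compact _ _ G _ fst UG Omega_compact.
  exact: filterT.
(* Off the window set the witness is arbitrary; [G] contains the set, so only its points count. *)
have /choice[zi ziP] : forall p, exists z, window_set M k p ->
    [/\ lip k z, forall t, `|z t| <= M, traj p.1 z (- r%:num) 0 & segW r z 0 = p.2].
  move=> p; have [[z zP]|nQ] := pselect (window_set M k p); first by exists z.
  by exists (fun=> 0).
have [|||z [kz zM tr cv]] := @limit_traj _ G fst zi w k M UG _ _ _ => //.
- by apply: filterS GQ => p /ziP[].
- by apply: filterS GQ => p /ziP[].
have tri : \forall p \near G, traj p.1 (zi p) (- r%:num) 0.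
  by apply: filterS GQ => p /ziP[].
exists (w, segW r z 0); split; first by exists z; split=> //; exact: tr.
have := cv 0; rewrite sub0r => /(_ tri).
rewrite sigma0; apply: cvg_trans; apply: near_eq_cvg.
by apply: filterS GQ => -[w' x'] /ziP[_ _ _ /= ->]; rewrite sigma0.
Qed.

Lemma window_closed M k : closed (window_set M k).
Proof. by apply: compact_closed; [exact: hausdorff_OW|exact: window_compact]. Qed.

(** The delicate point is continuity of the backward orbit in W^{1,oo}. It holds because all
    translates of [z] solve the equation on [-r, 0], so that [segW_cvg] applies to them. *)
Lemma entire_backward K w z k : lip k z -> (forall a b, traj w z a b) ->
  (forall s, s <= 0 -> K (sigma s w, segW r z s)) ->
  backward_extension K (w, segW r z 0).
Proof.
move=> kz tr Kz; exists (fun s => (sigma s w, segW r z s)); split=> //.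
- apply: continuous_subspaceT => s.
  have [cs _ _] := sigma_flow.
  have cw : sigma t w @[t --> s] --> sigma s w.
    by apply: (continuous2_cvg _ (cs (s, w)) cvg_id (cvg_cst w)).
  suff H : (sigma t w, segW r z t) @[t --> s] --> (sigma s w, segW r z s) by exact: H.
  apply: cvg_pair_nbhs => //.
  (* Segments at moving times become segments, at the fixed time 0, of translates. *)
  have E t : segW r z t = segW r (fun u => z (t + u)) 0.
    by rewrite segW_shift addr0.
  rewrite E; under eq_fun do rewrite E.
  apply: (@segW_cvg _ _ _ _ _ sigma_flow _ _ F_cont tau_cont _ (nbhs s) _
    (fun t u => z (t + u)) (fun u => z (s + u)) k _ _ _ _ cw).
  + apply: nearW => t u v; rewrite (le_trans (kz _ _))//.
    by rewrite opprD addrACA subrr add0r.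
  + move=> u; apply: (@cvg_comp _ _ _ (fun t => t + u) z _ (nbhs (s + u))).
      by apply: (@cvgD _ R^o); [exact: cvg_id|exact: cvg_cst].
    exact: lip_continuous kz _.
  + apply: nearW => t.
    have := @traj_shift _ _ _ _ _ sigma_flow _ _ _ _ t _ _ (tr (t - r%:num) t).
    by rewrite sub0r subrr addrAC subrr add0r.
- by rewrite sigma0.
- move=> s t t0 st; have [_ ->//] := traj_semiflow kz (tr s) (lexx s).
  by rewrite addrC.
Qed.

Lemma bounded_in_WP K : bounded_in_W K -> exists M, forall p, K p -> `|p.2| <= M.
Proof.
move=> [M [_ KM]]; exists (`|M| + 1) => p Kp.
apply: (KM (`|M| + 1)); last by exists p.
by rewrite (le_lt_trans (ler_norm _))// ltrDl.
Qed.

Lemma compact_bounded_in_W K : compact K -> bounded_in_W K.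
Proof.
move=> Kc; apply: compact_bounded; apply: continuous_compact Kc.
by apply: continuous_subspaceT => p; exact: cvg_snd.
Qed.

Lemma semiflow0 p : semiflow 0 p = p.
Proof.
have [sol _] := y_max p.1 p.2.
by rewrite /Defs.semiflow sigma0 (sol_segW0 sol) -surjective_pairing.
Qed.

Lemma cvg_fst_OW (G : set_system (Omega * W)) p : Filter G ->
  G --> p -> q.1 @[q --> G] --> p.1.
Proof.
by move=> FG Gp; apply: (@cvg_comp _ _ _ id fst G (nbhs p)) => //; exact: cvg_fst.
Qed.

(** [k] depends on the initial function of [p]; from time 0 on the constant is [L], the same for all
    of [K]. *)
Lemma pos_invariant_traj K M L p : pos_invariant K ->
  (forall q, K q -> `|q.2| <= M) -> F_bound F M L -> 0 <= L -> K p ->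
  exists k z, [/\ lip k z, forall t, `|z t| <= M, forall T, traj p.1 z 0 T,
    forall s t, 0 <= s -> s <= t -> `|z t - z s| <= L * (t - s) &
    forall t, 0 <= t -> semiflow t p = (sigma t p.1, segW r z t)].
Proof.
move=> Kinv KM FL L0 Kp; have [b_oo sK] := Kinv p Kp.
have yM t : 0 <= t -> `|segW r (y p.1 p.2) t| <= M.
  by move=> t0; exact: (KM (semiflow t p) (sK t t0)).
have [k [z [kz zp tr zM]]] := global_traj Omega_compact F_cont tau_range y_max FL L0 b_oo yM.
exists k, z; split=> //.
  by move=> s t s0 st; exact: (traj_lip tau_range FL _ (tr t)).
move=> t t0; have [_ /(_ t t0)] := traj_semiflow kz tr (lexx 0).
by rewrite sigma0 zp add0r -surjective_pairing.
Qed.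

(** With the origin of time moved to 2r, the equation covers [-2r, oo), so [L] bounds all slopes
    there; and from time -r on the delayed arguments stay in that range. *)
Lemma pos_invariant_past K M L p : pos_invariant K ->
  (forall q, K q -> `|q.2| <= M) -> F_bound F M L -> 0 <= L -> K p ->
  exists z, [/\ lip L z, forall t, `|z t| <= M,
    forall T, traj (sigma (2 * r%:num) p.1) z (- r%:num) T &
    forall t, 0 <= t -> semiflow (2 * r%:num) (semiflow t p) =
      (sigma t (sigma (2 * r%:num) p.1), segW r z t)].
Proof.
move=> Kinv KM FL L0 Kp; have r0 : 0 < r%:num by [].
have [k [z [kz zM tr zL sf]]] := pos_invariant_traj Kinv KM FL L0 Kp.
(* Frozen before -2r, since the slope is only bounded by [k] there. *)
pose Z t := z (2 * r%:num + Num.max (- (2 * r%:num)) t).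
have ZE t : - (2 * r%:num) <= t -> Z t = z (2 * r%:num + t).
  by move=> t1; rewrite /Z max_r.
exists Z; split.
- apply: lip_le => s t st.
  have st' : Num.max (- (2 * r%:num)) s <= Num.max (- (2 * r%:num)) t.
    by rewrite ge_max !le_max lexx st orbT.
  apply: le_trans (zL _ _ _ _) _; rewrite ?lerD2l//.
    by rewrite -lerBlDl sub0r le_max lexx.
  rewrite ler_wpM2l// opprD addrACA subrr add0r.
  by rewrite /Num.max; do ![case: ifPn]; rewrite -?leNgt; lra.
- by move=> t; exact: zM.
- move=> T.
  have := @traj_shift _ _ _ _ _ sigma_flow _ _ _ _ (2 * r%:num) _ _ (tr (2 * r%:num + T)).
  rewrite sub0r [_ + T]addrC addrK => trZ.
  apply: (eq_traj tau_range (y := fun t => z (2 * r%:num + t))).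
    by move=> s /andP[s1 _]; rewrite ZE// (le_trans _ s1)//; lra.
  by apply: has_rate_sub trZ => //; lra.
- move=> t t0; rewrite sf//.
  have [_ ->] := traj_semiflow kz tr t0; last by lra.
  rewrite (addrC t) -sigmaD (addrC t); congr pair.
  rewrite -segW_shift; apply: eq_segW => s /andP[s1 _].
  by rewrite ZE//; lra.
Qed.

Lemma image_closure_invariant K : pos_invariant K -> bounded_in_W K ->
  let K1 := closure [set semiflow (2 * r%:num) p | p in K] in
  pos_invariant K1 /\ compact K1.
Proof.
move=> Kinv /bounded_in_WP[M KM]; set A := [set _ | _ in _] => K1.
have [L L0 FL] := F_boundP Omega_compact F_cont M.
have past := pos_invariant_past Kinv KM FL L0.
split; last first.
  apply: (subclosed_compact _ (@window_compact M L)); first exact: closed_closure.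
  rewrite /K1; have /closure_id -> := @window_closed M L.
  apply: closureS => _ [p Kp <-]; have [z [kz zM tr sf]] := past p Kp.
  exists z; split; [exact: kz|exact: zM|exact: (tr 0)|].
  by have := sf 0 (lexx 0); rewrite sigma0 semiflow0 => -[].
move=> p /closure_ultra[G [UG GA Gp]].
have /choice[zi ziP] : forall q, exists z, A q -> [/\ lip L z,
    forall t, `|z t| <= M, forall T, traj q.1 z (- r%:num) T,
    forall t, 0 <= t -> A (sigma t q.1, segW r z t) & segW r z 0 = q.2].
  move=> q; have [[p' Kp' pq]|nA] := pselect (A q); last by exists (fun=> 0).
  have [z [kz zM tr sf]] := past p' Kp'; exists z => _; split=> //.
  - by rewrite -pq.
  (* The motions by [t] and by 2r commute, so invariance of [K] keeps the forward orbit in [A]. *)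
  - move=> t t0; rewrite -pq /= -sf//; exists (semiflow t p') => //.
    by have [_] := Kinv p' Kp'; exact.
  - by have := sf 0 (lexx 0); rewrite sigma0 semiflow0 pq => ->.
have kzi : \forall q \near G, lip L (zi q) by apply: filterS GA => q /ziP[].
have ziM : \forall q \near G, forall t, `|zi q t| <= M.
  by apply: filterS GA => q /ziP[].
have [z [kz zM tr cv]] := limit_traj UG kzi ziM (cvg_fst_OW _ Gp).
have {}cv t : 0 <= t -> (sigma t q.1, segW r (zi q) t) @[q --> G] -->
    (sigma t p.1, segW r z t).
  move=> t0; apply: cv; apply: filterS GA => q /ziP[_ _ trq _ _].
  by apply: has_rate_sub (trq t) => //; rewrite lerBrDr addNr.
have {}tr T : traj p.1 z (- r%:num) T.
  by apply: tr; apply: filterS GA => q /ziP[].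
have pz : p = (p.1, segW r z 0).
  apply: (cvg_unique hausdorff_OW Gp); have := cv 0 (lexx 0); rewrite sigma0.
  apply: cvg_trans; apply: near_eq_cvg; apply: filterS GA => -[q1 q2] /ziP[_ _ _ _ /= ->].
  by rewrite sigma0.
have [|b_oo sf] := traj_semiflow kz tr (_ : _ <= 0); first by rewrite oppr_le0.
rewrite sigma0 in b_oo sf.
(* No continuity of the semiflow is invoked: the image of [p] and the images of the nearby points
   are all read off trajectories, which converge at time [t]. *)
rewrite pz; split=> // t t0; rewrite sf// add0r.
apply: (closed_cvg _ (@closed_closure _ A) _ _ (cv t t0)).
by apply: filterS GA => q /ziP[_ _ _ Aq _]; apply: subset_closure; exact: Aq.
Qed.

(** The intersection of the closures of the tails is a form without sequences that suits filters.
    Conversely, balls of radius 1/(m + 1) around [p] supply the times. *)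
Lemma omega_limitE q : omega_limit q = [set p | forall T,
  closure [set semiflow t q | t in [set t | T <= t]] p].
Proof.
apply/seteqP; split=> [p [t_ [_ _ too cv]] T|p cl].
  apply: (closed_cvg _ (@closed_closure _ _) _ _ cv).
  have /cvgryPge /(_ T) := too.
  by apply: filterS => m Tm; apply: subset_closure; exists (t_ m).
have /choice[g gP] : forall Tm : R * nat, exists t, Tm.1 <= t /\
    ball p (Tm.2.+1%:R^-1) (semiflow t q).
  move=> [T m]; have [|_ [[t Tt <-] bt]] := cl T (ball p (m.+1%:R^-1)).
    by apply: nbhsx_ballx; rewrite invr_gt0.
  by exists t.
(* The maximum with the previous time gives monotonicity, the maximum with the index gives
   divergence. *)
pose t_ := fix t_ m := if m is m'.+1 then g (Num.max (t_ m') m%:R, m) else g (0, 0%N).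
have tS m : t_ m.+1 = g (Num.max (t_ m) m.+1%:R, m.+1) by [].
have t0 : 0 <= t_ 0%N by have [] := gP (0, 0%N).
have tmono m : t_ m <= t_ m.+1.
  by rewrite tS; have [/= + _] := gP (Num.max (t_ m) m.+1%:R, m.+1); rewrite ge_max => /andP[].
have tge m : m%:R <= t_ m.
  case: m => // m; rewrite tS.
  by have [/= + _] := gP (Num.max (t_ m) m.+1%:R, m.+1); rewrite ge_max => /andP[].
have tball m : ball p (m.+1%:R^-1) (semiflow (t_ m) q).
  case: m => [|m]; first by have [] := gP (0, 0%N).
  by rewrite tS; have [] := gP (Num.max (t_ m) m.+1%:R, m.+1).
exists t_; split.
- by move=> m; apply: le_trans (tge m).
- exact/nondecreasing_seqP.
- by apply: ger_cvgy (cvgr_idn); apply: nearW.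
- apply/cvg_ballP => e e0; near=> m.
  apply: le_ball (tball m); apply: ltW; near: m; exact: near_infty_natSinv_lt (PosNum e0).
Unshelve. all: by end_near. Qed.

Lemma traj_shift_at w z T t a b : traj w z T b -> T <= t + a ->
  traj (sigma t w) (fun u => z (t + u)) a (b - t).
Proof.
move=> tr Tta; apply: has_rate_sub (traj_shift (a := t) sigma_flow tr) => //.
by rewrite lerBlDl.
Qed.

(** * The omega-limit set of a bounded orbit *)

Section omega_limit_set.
Context (q : Omega * W) (z : R -> V) (k M : R).
Hypothesis kz : lip k z.
Hypothesis zM : forall t, `|z t| <= M.
Hypothesis trz : forall T, traj q.1 z 0 T.
Hypothesis qz : q.2 = segW r z 0.

Let sfE t : 0 <= t -> semiflow t q = (sigma t q.1, segW r z t).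
Proof.
move=> t0; have [_ /(_ t t0)] := traj_semiflow kz trz (lexx 0).
by rewrite sigma0 add0r -qz -surjective_pairing.
Qed.

(** With a single orbit, [k] may depend on its initial function, so one delay [r] is enough to enter
    the window set. *)
Let sub_window : [set semiflow t q | t in [set t | r%:num <= t]] `<=` window_set M k.
Proof.
move=> _ [t /= rt <-]; have t0 : 0 <= t by exact: le_trans rt.
rewrite sfE//; exists (fun u => z (t + u)); split=> //=.
- by move=> u v; rewrite (le_trans (kz _ _))// opprD addrACA subrr add0r.
- have := @traj_shift_at q.1 z 0 t (- r%:num) t (@trz t); rewrite subrr; apply.
  by rewrite subr_ge0.
- by rewrite segW_shift addr0.
Qed.

Lemma omega_limit_precompact :
  precompact [set semiflow t q | t in [set t | r%:num <= t]].
Proof.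
exists (window_set M k); first exact: sub_window.
by split; [exact: window_compact|exact: window_closed].
Qed.

Lemma omega_limit_closed : closed (omega_limit q).
Proof.
rewrite omega_limitE => p cl T; apply: closed_closure => A pA.
by have [x [/(_ T) ? ?]] := cl A pA; exists x.
Qed.

Lemma omega_limit_compact : compact (omega_limit q).
Proof.
apply: (subclosed_compact omega_limit_closed (@window_compact M k)).
rewrite omega_limitE => p /(_ r%:num).
by have /closure_id -> := @window_closed M k; apply: closureS; exact: sub_window.
Qed.

(** Provides, in (iii), a point that admits a backward extension. *)
Lemma omega_limit_nonempty : omega_limit q !=set0.
Proof.
have FF : ProperFilter (semiflow t q @[t --> +oo]) by exact: fmap_proper_filter.
have [|p [_ clp]] := @window_compact M k (semiflow t q @[t --> +oo]) FF.
  apply: filterS (nbhs_pinfty_ge (num_real r%:num)) => t rt.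
  by apply: sub_window; exists t.
exists p; rewrite omega_limitE => T A pA; apply: clp => //.
by apply: filterS (nbhs_pinfty_ge (num_real T)) => t Tt; exists t.
Qed.

(** The translates of [z] by [t_ m] solve the equation from [- t_ m] on, hence eventually on any
    [a, b], so their limit is an entire trajectory. Its segments are limits of orbit points at the
    times [t_ m + s]. *)
Lemma omega_limit_entire p : omega_limit q p -> exists Z, [/\ lip k Z,
  segW r Z 0 = p.2, forall a b, traj p.1 Z a b &
  forall s, omega_limit q (sigma s p.1, segW r Z s)].
Proof.
move=> [t_ [_ _ too cv]].
have [G [UG sG]] := @ultraFilterLemma _ (\oo : set_system nat) _.
have cvG : semiflow (t_ m) q @[m --> G] --> p.
  by apply: cvg_trans cv => A; exact: sG.
have tge T : \forall m \near G, T <= t_ m.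
  by apply: sG; move/cvgryPge : too; exact.
pose zi m u := z (t_ m + u).
have kzi : \forall m \near G, lip k (zi m).
  apply: nearW => m u v; rewrite (le_trans (kz _ _))//.
  by rewrite opprD addrACA subrr add0r.
have ziM : \forall m \near G, forall t, `|zi m t| <= M by apply: nearW => m t; exact: zM.
have wi : sigma (t_ m) q.1 @[m --> G] --> p.1.
  apply: (@cvg_comp _ _ _ (fun m => semiflow (t_ m) q) fst G (nbhs p)) => //.
  exact: cvg_fst.
have [Z [kZ _ tr cvZ]] := limit_traj UG kzi ziM wi.
have tri a b : \forall m \near G, traj (sigma (t_ m) q.1) (zi m) a b.
  apply: filterS (tge (- a)) => m am.
  have := @traj_shift_at q.1 z 0 (t_ m) a (t_ m + b) (@trz _).
  by rewrite [t_ m + b]addrC addrK; apply; rewrite -lerBlDr sub0r.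
have {}cvZ s : semiflow (t_ m + s) q @[m --> G] --> (sigma s p.1, segW r Z s).
  have := cvZ s (tri _ _); apply: cvg_trans; apply: near_eq_cvg.
  apply: filterS (tge (- s)) => m sm.
  rewrite sfE; last by rewrite -lerBlDr sub0r.
  by rewrite segW_shift addrC -sigmaD [s + _]addrC.
exists Z; split=> //; [|by move=> a b; exact: tr|].
- have := cvZ 0; under eq_fun do rewrite addr0.
  by move=> /(cvg_unique hausdorff_OW cvG) ->.
- move=> s; rewrite omega_limitE => T.
  apply: (closed_cvg _ (@closed_closure _ _) _ _ (cvZ s)).
  apply: filterS (tge (T - s)) => m Tm; apply: subset_closure.
  by exists (t_ m + s) => //=; rewrite -lerBlDr.
Qed.

Lemma omega_limit_backward p : omega_limit q p ->
  backward_extension (omega_limit q) p.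
Proof.
move=> /omega_limit_entire[Z [kZ pZ trZ oZ]].
rewrite [p]surjective_pairing -pZ.
by apply: (entire_backward kZ trZ) => s _; exact: oZ.
Qed.

Lemma omega_limit_invariant : pos_invariant (omega_limit q).
Proof.
move=> p /omega_limit_entire[Z [kZ pZ trZ oZ]].
have [b_oo sf] := traj_semiflow kZ (trZ 0) (lexx 0).
rewrite [p]surjective_pairing -pZ /=; rewrite sigma0 in b_oo sf.
by split=> // t t0; rewrite sf// add0r; exact: oZ.
Qed.

End omega_limit_set.

Lemma omega_limit_bounded_semiorbit q : bounded_in_W (semiorbit sigma beta y q) ->
  [/\ omega_well_defined sigma beta y q,
      pos_invariant (omega_limit q), omega_limit q !=set0,
      compact (omega_limit q) &
      forall p, omega_limit q p -> backward_extension (omega_limit q) p].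
Proof.
move=> /bounded_in_WP[M qM].
have yM t : 0 <= t -> (t%:E < beta q.1 q.2)%E -> `|segW r (y q.1 q.2) t| <= M.
  by move=> t0 tb; apply: (qM (semiflow t q)); exists t.
have b_oo := bounded_beta Omega_compact sigma_flow F_cont tau_cont tau_range y_max yM.
have [L L0 FL] := F_boundP Omega_compact F_cont M.
have [|k [z [kz qz tr zM]]] := global_traj Omega_compact F_cont tau_range y_max FL L0 b_oo.
  by move=> t t0; apply: yM => //; rewrite b_oo ltry.
split.
- by split=> //; exact: omega_limit_precompact kz zM tr (esym qz).
- exact: omega_limit_invariant kz zM tr (esym qz).
- exact: omega_limit_nonempty kz zM tr (esym qz).
- exact: omega_limit_compact kz zM tr (esym qz).
- exact: omega_limit_backward kz zM tr (esym qz).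
Qed.

(** * The points of an invariant compact set with a backward extension *)

Section invariant_compact.
Context (K : set (Omega * W)) (M L : R).
Hypothesis Kinv : pos_invariant K.
Hypothesis Kcompact : compact K.
Hypothesis KM : forall p, K p -> `|p.2| <= M.
Hypothesis L0 : 0 <= L.
Hypothesis FL : F_bound F M L.

(** The bounds [L] and [M] are common to all points, which lets the property pass to limits. *)
Definition entire_in p := exists z, [/\ lip L z, forall t, `|z t| <= M,
  segW r z 0 = p.2, forall a b, traj p.1 z a b &
  forall s, K (sigma s p.1, segW r z s)].

(* The restrictions of the backward extension to [-N, 0], each continued by the
   semiflow, are consistent and define an entire trajectory. *)
Lemma backward_entire p : K p -> backward_extension K p -> entire_in p.
Proof.
move=> Kp [th [_ thK th0 thS]].
pose Th s := if s <= 0 then th s else semiflow s p.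
pose Z s := (Th s).2 0.
have base N : 0 <= N -> exists k z, [/\ lip k z, forall t, `|z t| <= M,
    forall T, traj (th (- N)).1 z 0 T,
    forall s t, 0 <= s -> s <= t -> `|z t - z s| <= L * (t - s) &
    forall s, - N <= s -> Th s = (sigma (N + s) (th (- N)).1, segW r z (N + s))].
  move=> N0; have Kt : K (th (- N)) by apply: thK; rewrite oppr_le0.
  have [k [z [kz zM tr zL sf]]] := pos_invariant_traj Kinv KM FL L0 Kt.
  have pE : p = (sigma N (th (- N)).1, segW r z N).
    by rewrite -sf// thS// addrN th0.
  exists k, z; split=> // s Ns; rewrite /Th; case: (leP s 0) => s0.
    have Ns0 : 0 <= N + s by lra.
    rewrite -(sf _ Ns0) thS//; last by lra.
    by congr th; lra.
  have [_ sf'] := traj_semiflow kz tr N0.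
  by rewrite {1}pE sf' ?ltW.
have ZE N : 0 <= N -> exists k z, [/\ lip k z, forall t, `|z t| <= M,
    forall T, traj (th (- N)).1 z 0 T,
    forall s t, 0 <= s -> s <= t -> `|z t - z s| <= L * (t - s) &
    (forall s, - N <= s -> Th s = (sigma (N + s) (th (- N)).1, segW r z (N + s)))
    /\ (forall s, - N <= s -> Z s = z (N + s))].
  move=> N0; have [k [z [kz zM tr zL ThE]]] := base N N0.
  exists k, z; split=> //; split=> // s Ns.
  by rewrite /Z ThE// (segW_lip0 _ _ kz).
have Th0 : Th 0 = p by rewrite /Th lexx.
(* Seen from the starting time -|s|, both times are nonnegative, where the slope is bounded by [L]
   and not only by the [k] of the starting point. *)
have LZ : lip L Z.
  apply: lip_le => s t st; have [k [z [kz zM tr zL [_ zE]]]] := ZE `|s| (normr_ge0 _).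
  have s1 : - `|s| <= s by rewrite lerNl ler_normr lexx orbT.
  rewrite !zE// ?(le_trans s1)//.
  apply: le_trans (zL _ _ _ _) _; rewrite ?lerD2l// -?lerBlDl ?sub0r//.
  by rewrite opprD addrACA subrr add0r.
have ThE s : Th s = (sigma s p.1, segW r Z s).
  (* The extra [r] puts the whole of [s - r, s] after the starting time. *)
  have N0 : 0 <= `|s| + r%:num by rewrite addr_ge0.
  have [k [z [kz zM tr zL [ThE zE]]]] := ZE _ N0.
  have s1 : - `|s| <= s by rewrite lerNl ler_normr lexx orbT.
  have rs : - (`|s| + r%:num) <= s - r%:num by rewrite opprD lerD2r.
  have Ns : - (`|s| + r%:num) <= s by rewrite (le_trans rs)// gerBl.
  have -> : p.1 = sigma (`|s| + r%:num) (th (- (`|s| + r%:num))).1.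
    by rewrite -Th0 ThE ?oppr_le0// addr0.
  rewrite ThE// -sigmaD [s + _]addrC; congr pair.
  rewrite -segW_shift; apply: eq_segW => u /andP[u1 _].
  by rewrite zE// (le_trans rs).
exists Z; split=> //.
- by move=> t; have [k [z [_ zM _ _ [_ zE]]]] := ZE `|t| (normr_ge0 _);
    rewrite zE// lerNl ler_normr lexx orbT.
- by have := ThE 0; rewrite Th0 => ->.
(* The extra [r] covers the past that the equation at time [a] looks at. *)
- move=> a b; have N0 : 0 <= `|a| + r%:num by rewrite addr_ge0.
  have [k [z [kz zM tr zL [Th_E zE]]]] := ZE _ N0.
  have a1 : - `|a| <= a by rewrite lerNl ler_normr lexx orbT.
  have -> : p.1 = sigma (`|a| + r%:num) (th (- (`|a| + r%:num))).1.
    by rewrite -Th0 Th_E ?oppr_le0// addr0.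
  apply: (eq_traj tau_range (y := fun u => z (`|a| + r%:num + u))).
    move=> u /andP[u1 _]; rewrite zE// (le_trans _ u1)//.
    by rewrite opprD lerD2r.
  have := @traj_shift_at _ z 0 (`|a| + r%:num) a (`|a| + r%:num + b) (@tr _).
  rewrite [_ + b]addrC addrK; apply.
  by rewrite addrAC addr_ge0// -lerBlDl sub0r.
- move=> s; rewrite -ThE /Th; case: (leP s 0) => [/thK//|/ltW s0].
  by have [_] := Kinv Kp; exact.
Qed.

Lemma entire_in_shift p z : lip L z -> (forall t, `|z t| <= M) ->
  (forall a b, traj p.1 z a b) -> (forall s, K (sigma s p.1, segW r z s)) ->
  forall s, entire_in (sigma s p.1, segW r z s).
Proof.
move=> Lz zM tr Kz s; exists (fun u => z (s + u)); split=> //=.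
- by move=> u v; rewrite (le_trans (Lz _ _))// opprD addrACA subrr add0r.
- by rewrite segW_shift addr0.
- move=> a b; have := @traj_shift_at _ z (s + a) s a (s + b) (@tr _ _).
  by rewrite [s + b]addrC addrK; exact.
- by move=> u; rewrite segW_shift -sigmaD addrC.
Qed.

Lemma entire_inP p : (K p /\ backward_extension K p) <-> entire_in p.
Proof.
split=> [[Kp bp]|[z [Lz _ zp tr Kz]]]; first exact: backward_entire.
rewrite [p]surjective_pairing -zp; split; first by have := Kz 0; rewrite sigma0.
by apply: (entire_backward Lz tr) => s _; exact: Kz.
Qed.

Let K3 := [set p | K p /\ backward_extension K p].

(** Each point of an entire trajectory in [K] lies on a translate of it, so the trajectory stays in
    [K3]. Invariance and backward extensions inside [K3] both follow. *)
Lemma backward_set_entire p : K3 p -> exists z, [/\ lip L z, segW r z 0 = p.2,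
  forall a b, traj p.1 z a b & forall s, K3 (sigma s p.1, segW r z s)].
Proof.
move=> /entire_inP[z [Lz zM zp tr Kz]]; exists z; split=> // s.
by apply/entire_inP; exact: entire_in_shift.
Qed.

Lemma backward_set_backward p : K3 p -> backward_extension K3 p.
Proof.
move=> /backward_set_entire[z [Lz zp tr Kz]].
rewrite [p]surjective_pairing -zp.
by apply: (entire_backward Lz tr) => s _; exact: Kz.
Qed.

Lemma backward_set_invariant : pos_invariant K3.
Proof.
move=> p /backward_set_entire[z [Lz zp tr Kz]].
have [b_oo sf] := traj_semiflow Lz (tr 0) (lexx 0).
rewrite [p]surjective_pairing -zp /=; rewrite sigma0 in b_oo sf.
by split=> // t t0; rewrite sf// add0r; exact: Kz.
Qed.

(** Backward extensions come without uniform control; [entire_inP] trades them for entire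
    trajectories with common bounds, whose limits [limit_traj] describes. *)
Lemma backward_set_compact : compact K3.
Proof.
have Kcl : closed K by exact: compact_closed hausdorff_OW Kcompact.
apply: subclosed_compact Kcompact _; last by move=> p [].
move=> p /closure_ultra[G [UG GA Gp]].
have /choice[zi ziP] : forall q, exists z, K3 q -> [/\ lip L z,
    forall t, `|z t| <= M, segW r z 0 = q.2, forall a b, traj q.1 z a b &
    forall s, K (sigma s q.1, segW r z s)].
  move=> q; have [/entire_inP[z zP]|nA] := pselect (K3 q); first by exists z.
  by exists (fun=> 0).
have kzi : \forall q \near G, lip L (zi q) by apply: filterS GA => q /ziP[].
have ziM : \forall q \near G, forall t, `|zi q t| <= M.
  by apply: filterS GA => q /ziP[].
have [z [Lz zM tr cv]] := limit_traj UG kzi ziM (cvg_fst_OW _ Gp).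
have tri a b : \forall q \near G, traj q.1 (zi q) a b.
  by apply: filterS GA => q /ziP[_ _ _ + _]; exact.
apply/entire_inP; exists z; split=> //.
- have : (p.1, segW r z 0) = p; last by move=> <-.
  apply: (cvg_unique hausdorff_OW _ Gp); have := cv 0 (tri _ _); rewrite sigma0.
  apply: cvg_trans; apply: near_eq_cvg; apply: filterS GA => -[q1 q2] /ziP[_ _ /= -> _ _].
  by rewrite sigma0.
- by move=> a b; exact: tr.
- move=> s; apply: (closed_cvg _ Kcl _ _ (cv s (tri _ _))).
  by apply: filterS GA => q /ziP[_ _ _ _]; exact.
Qed.

End invariant_compact.

(** The omega-limit set of any point of [K] lies in [K], which is closed, and its backward
    extensions are backward extensions in [K]. *)
Lemma backward_set_nonempty K : K !=set0 -> pos_invariant K -> compact K ->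
  [set p | K p /\ backward_extension K p] !=set0.
Proof.
move=> [q Kq] Kinv Kc.
have Kcl : closed K by exact: compact_closed hausdorff_OW Kc.
have [N [Nr NK]] := compact_bounded_in_W Kc.
have qB : bounded_in_W (semiorbit sigma beta y q).
  exists N; split=> // N' NN' _ [_ [t [t0 _] <-] <-]; apply: NK NN' _ _.
  by exists (semiflow t q) => //; have [_] := Kinv q Kq; exact.
have [_ _ [p op] _ oB] := omega_limit_bounded_semiorbit qB.
have oK : omega_limit q `<=` K.
  move=> {op} {}p [t_ [t0 _ _ cv]]; apply: (closed_cvg _ Kcl _ _ cv).
  by apply: nearW => m; have [_] := Kinv q Kq; exact.
exists p; split; first exact: oK.
have [th [cth thO th0 thS]] := oB p op; exists th; split=> // s s0.
by apply: oK; exact: thO.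
Qed.

End semiflow_sets.

Theorem theorem3p6 (R : realType) (r : {posnum R}) (n : nat)
  (n_gt0 : (0 < n)%N)
  (Omega : metricType R) (Omega_compact : compact [set: Omega])
  (sigma : R -> Omega -> Omega) (sigma_flow : continuous_flow sigma)
  (F : Omega * 'rV[R]_n * 'rV[R]_n -> 'rV[R]_n)
  (tau : Omega * Cspace r n -> R)
  (tau_range : forall p, 0 <= tau p <= r%:num)
  (F_H1 : cond_H1 F) (tau_H2_1 : cond_H2_1 tau)
  (beta : Omega -> W1oo r n -> \bar R) (y : Omega -> W1oo r n -> R -> 'rV[R]_n)
  (y_max : forall w x,
    is_maximal_solution sigma F tau w x (beta w x) (y w x)) :
  (forall K0 : set (Omega * W1oo r n),
    pos_invariant sigma beta y K0 -> bounded_in_W K0 ->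
    let K1 := closure [set semiflow sigma y (2 * r%:num) p | p in K0] in
    pos_invariant sigma beta y K1 /\ compact K1)
  /\
  (forall q : Omega * W1oo r n,
    bounded_in_W (semiorbit sigma beta y q) ->
    [/\ omega_well_defined sigma beta y q,
        pos_invariant sigma beta y (omega_limit sigma y q),
        compact (omega_limit sigma y q) &
        forall p, omega_limit sigma y q p ->
          backward_extension sigma y (omega_limit sigma y q) p])
  /\
  (forall K2 : set (Omega * W1oo r n),
    K2 !=set0 -> pos_invariant sigma beta y K2 -> compact K2 ->
    let K3 := [set p | K2 p /\ backward_extension sigma y K2 p] in
    [/\ K3 !=set0,
        pos_invariant sigma beta y K3,
        compact K3,
        forall p, K3 p -> backward_extension sigma y K3 p &
        forall K : set (Omega * W1oo r n), K `<=` K2 ->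
          pos_invariant sigma beta y K -> compact K ->
          (forall p, K p -> backward_extension sigma y K p) ->
          K `<=` K3]).
Proof.
have [F_cont _ _ _ _] := F_H1; have [tau_cont _ _] := tau_H2_1.
split; [|split].
- move=> K0; exact: (image_closure_invariant Omega_compact sigma_flow F_cont
    tau_cont tau_range y_max).
- move=> q qB; have [wd inv _ cpt bwd] := omega_limit_bounded_semiorbit Omega_compact
    sigma_flow F_cont tau_cont tau_range y_max qB.
  by split.
- move=> K2 K2n0 K2inv K2c K3.
  have [M KM] := bounded_in_WP (compact_bounded_in_W K2c).
  have [L L0 FL] := F_boundP Omega_compact F_cont M.
  split.
  + exact: (backward_set_nonempty Omega_compact sigma_flow F_cont tau_cont
      tau_range y_max K2n0 K2inv K2c).
  + exact: (backward_set_invariant Omega_compact sigma_flow F_cont tau_cont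
      tau_range y_max K2inv KM L0 FL).
  + exact: (backward_set_compact Omega_compact sigma_flow F_cont tau_cont
      tau_range y_max K2inv K2c KM L0 FL).
  + exact: (backward_set_backward Omega_compact sigma_flow F_cont tau_cont
      tau_range y_max K2inv KM L0 FL).
  + move=> K KK2 _ _ Kb p Kp; split; first exact: KK2.
    have [th [cth thK th0 thS]] := Kb p Kp; exists th; split=> // s s0.
    by apply: KK2; exact: thK.
Qed.
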